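(* Let $k$ be a field and $R=k[x_1,\ldots,x_n]$. Assume that the lex plus powers conjecture for socles holds, i.e. that the following statement is true: for every list $\mathbb{B}=\{b_1,\ldots,b_n\}$ of integers with $1\le b_1\le\cdots\le b_n$, every $\mathbb{B}$-lex plus powers ideal $M\subset R$ and every homogeneous ideal $J\subset R$ containing a $\mathbb{B}$-regular sequence with $H(R/M)=H(R/J)$, one has $\beta^M_{n,j}\ge\beta^J_{n,j}$ for all $j$. Let $L\subset R$ be a lex plus powers ideal with respect to $\mathbb{A}=\{a_1,\ldots,a_n\}$, and let $I\subset R$ be a homogeneous ideal containing an $\mathbb{A}$-regular sequence such that $H(R/L)=H(R/I)$. Then $\beta^L_{1,j}\ge\beta^I_{1,j}$ for all $j$.
   Context: $R=k[x_1,\ldots,x_n]$ is standard graded; monomials are ordered lexicographically with $x_1>\cdots>x_n$. $H(R/I)=\{\dim_k(R/I)_d\}_{d\ge0}$ is the Hilbert function of $R/I$. The graded Betti numbers are $\beta^I_{i,j}=\dim_k \mathrm{Tor}^R_i(R/I,k)_j$ (so they are those of $R/I$). For a list of integers $1\le a_1\le\cdots\le a_n$, an $\mathbb{A}=\{a_1,\ldots,a_n\}$-regular sequence is a regular sequence $f_1,\ldots,f_n$ of homogeneous forms in $R$ with $\deg f_i=a_i$ for all $i$. A monomial ideal $L\subset R$ is an $\mathbb{A}$-lex plus powers ideal (lex plus powers with respect to $\mathbb{A}$) if it is minimally generated by monomials $x_1^{a_1},\ldots,x_n^{a_n},m_1,\ldots,m_l$ such that for each $j$ all monomials of degree $\deg(m_j)$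 that are larger than $m_j$ in lex order lie in $L$. *)

(* Defs.v *)
From HB Require Import structures.
From mathcomp Require Import all_boot all_order all_algebra.
From mathcomp.multinomials Require Export mpoly.
From Stdlib Require Import ClassicalEpsilon.

Set Implicit Arguments.
Unset Strict Implicit.
Unset Printing Implicit Defensive.
Import Order.TTheory GRing.Theory.
Local Open Scope ring_scope.

(* [is_qdim Z B d]: the image of Z in the k-vector space V / B has dimension
   d, i.e. d = dim_k Z / (Z \cap B).  It is only used for subspaces Z and B. *)
Definition is_qdim (k : fieldType) (V : lmodType k) (Z B : V -> Prop)
    (d : nat) : Prop :=
  exists v : 'I_d -> V,
    [/\ forall i, Z (v i),
        forall c : 'I_d -> k, B (\sum_i c i *: v i) -> forall i, c i = 0
      & forall z, Z z -> exists c : 'I_d -> k, B (z - \sum_i c i *: v i)].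

(* Unspecified when the dimension is infinite; below it is only applied in a
   fixed degree, where all spaces are finite dimensional. *)
Definition qdim (k : fieldType) (V : lmodType k) (Z B : V -> Prop) : nat :=
  epsilon (inhabits 0%N) (is_qdim Z B).

Section Ideals.
Variables (k : fieldType) (n : nat).
Implicit Types (I L : {mpoly k[n]} -> Prop) (a : 'I_n -> nat).

Definition is_ideal I : Prop :=
  [/\ I 0, forall p q, I p -> I q -> I (p + q) & forall r p, I p -> I (r * p)].

Definition homogeneous_ideal I : Prop :=
  is_ideal I /\ forall p d, I p -> I (pihomog mdeg d p).

Definition ideal_gen (s : seq {mpoly k[n]}) (p : {mpoly k[n]}) : Prop :=
  exists c : 'I_(size s) -> {mpoly k[n]}, p = \sum_i c i * s`_i.

(* dim_k (R/I)_d *)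
Definition hilbert I (d : nat) : nat :=
  qdim (fun p : {mpoly k[n]} => p \is d.-homog) I.

Definition degree_list a : Prop :=
  (forall i, 1 <= a i)%N /\ (forall i j : 'I_n, i <= j -> a i <= a j)%N.

Definition regular_sequence (f : 'I_n -> {mpoly k[n]}) : Prop :=
  (forall (i : 'I_n) g,
      ideal_gen [seq f j | j : 'I_n <- enum 'I_n & (j < i)%N] (g * f i) ->
      ideal_gen [seq f j | j : 'I_n <- enum 'I_n & (j < i)%N] g)
  /\ ~ ideal_gen [seq f j | j <- enum 'I_n] 1.

Definition contains_regular_sequence a I : Prop :=
  exists f : 'I_n -> {mpoly k[n]},
    [/\ forall i, f i \is (a i).-homog, regular_sequence f & forall i, I (f i)].

(* x_0 > ... > x_{n-1}.  Written out because the order that 'X_{1..n} carries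
   in the library compares total degrees first. *)
Definition lex_lt (m m' : 'X_{1..n}) : Prop :=
  exists i : 'I_n, (forall j : 'I_n, (j < i)%N -> m j = m' j) /\ (m i < m' i)%N.

Definition minimal_generators (G : seq {mpoly k[n]}) L : Prop :=
  (forall p, L p <-> ideal_gen G p)
  /\ (forall s1 g s2, G = s1 ++ g :: s2 -> ~ ideal_gen (s1 ++ s2) g).

Definition lex_plus_powers a L : Prop :=
  exists ms : seq 'X_{1..n},
    minimal_generators
      ([seq 'X_i ^+ a i | i <- enum 'I_n] ++ [seq 'X_[m] | m <- ms]) L
    /\ (forall m m' : 'X_{1..n},
          m \in ms -> mdeg m' = mdeg m -> lex_lt m m' -> L 'X_[m']).

End Ideals.

Section Tor.
Variables (k : fieldType) (n : nat).

(* A sequence ... -> F_1 -> F_0 -> k of finite free graded R-modules: F_i has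
   the basis [bas i], the basis element b being in degree [bdeg b], so
   F_i = \bigoplus_b R(- bdeg b), and is represented by {ffun bas i -> R}.
   The differential F_(i+1) -> F_i sends the basis element a to
   \sum_b dif a b * b, and the augmentation sends b to [aug b]. *)
Record graded_free_sequence := GradedFreeSequence {
  bas : nat -> finType;
  bdeg : forall i, bas i -> nat;
  dif : forall i, bas i.+1 -> bas i -> {mpoly k[n]};
  aug : bas 0 -> k
}.

Variable F : graded_free_sequence.

Definition free_mod (i : nat) := {ffun bas F i -> {mpoly k[n]}}.

Definition fdiff (i : nat) (g : free_mod i.+1) : free_mod i :=
  [ffun b => \sum_a g a * dif a b].

(* R acts on k = R/(x_0, ..., x_{n-1}) through the constant coefficient. *)
Definition augment (g : free_mod 0) : k := \sum_b (g b)@_0%MM * aug b.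

Definition graded_free_resolution_of_k : Prop :=
  [/\ (* the maps are homogeneous of degree 0 *)
      (forall i (a : bas F i.+1) (b : bas F i) m,
        m \in msupp (dif a b) -> (mdeg m + bdeg b)%N = bdeg a),
      (forall b : bas F 0, aug b != 0 -> bdeg b = 0%N),
      (* F_1 -> F_0 -> k -> 0 is exact *)
      (forall c : k, exists g, augment g = c),
      (forall g, augment g = 0 <-> exists h, g = fdiff h)
    & (* ... -> F_2 -> F_1 -> F_0 is exact *)
      (forall i (g : free_mod i.+1), fdiff g = 0 <-> exists h, g = fdiff h)].

Variable I : {mpoly k[n]} -> Prop.

Definition in_degree (i j : nat) (g : free_mod i) : Prop :=
  forall b m, m \in msupp (g b) -> (mdeg m + bdeg b)%N = j.

(* g represents a cycle, resp. a boundary, of the complex F \otimes_R R/I. *)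
Definition tor_cycle (i : nat) : free_mod i -> Prop :=
  match i with
  | 0 => fun _ => True
  | i'.+1 => fun g => forall b, I (fdiff g b)
  end.

Definition tor_boundary (i : nat) (g : free_mod i) : Prop :=
  exists h : free_mod i.+1, forall b, I (g b - fdiff h b).

(* dim_k H_i(F \otimes_R R/I)_j *)
Definition tor_dim (i j : nat) : nat :=
  qdim (fun g : free_mod i => in_degree j g /\ tor_cycle g) (@tor_boundary i).

End Tor.

Section Koszul.
Variables (k : fieldType) (n : nat).
Local Notation R := {mpoly k[n]}.
Implicit Types (S T : {set 'I_n}) (G : {set 'I_n} -> R) (l m : 'I_n).

Definition koszul_sign l S : R := (-1) ^+ #|[set m in S | (m < l)%N]|.

Definition koszul_dif S T : R :=
  \sum_(l in S | T == S :\ l) koszul_sign l S * 'X_l.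

Definition koszul : graded_free_sequence k n :=
  @GradedFreeSequence k n
    (fun i => {S : {set 'I_n} | #|S| == i})
    (fun i _ => i)
    (fun i a b => koszul_dif (val a) (val b))
    (fun _ => 1).

Let D G T : R := \sum_(l | l \notin T) koszul_sign l T * 'X_l * G (l |: T).


Let mcoeff_mulX l (p : R) u :
  ('X_l * p)@_u = if (0 < u l)%N then p@_(u - U_(l))%MM else 0.
Proof.
rewrite mulrC; case: ifP => [u_gt0 | u0].
  have {1}-> : u = (U_(l) + (u - U_(l)))%MM.
    rewrite addmC submK //; apply/mnm_lepP => j; rewrite mnm1E.
    by case: eqP => [<-|].
  by rewrite mcoeffMX.
apply/eqP; rewrite mcoeff_eq0; apply/negP => /msuppM_le.
case/allpairsP => -[v w] /= [_]; rewrite msuppX inE => /eqP-> Eu.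
by move: u0; rewrite Eu mnmDE mnm1E eqxx addn1.
Qed.

Let sg l S : k := (-1) ^+ #|[set m in S | (m < l)%N]|.

Let mcoeff_sign l S (p : R) u : (koszul_sign l S * p)@_u = sg l S * p@_u.
Proof.
rewrite /koszul_sign /sg -!(signr_odd _ #|_|).
by case: (odd _); rewrite ?expr1 ?expr0 ?mulN1r ?mul1r ?mcoeffN.
Qed.

Let mcoeffD_ G T u :
  (D G T)@_u =
  \sum_(l | (l \notin T) && (0 < u l)%N) sg l T * (G (l |: T))@_(u - U_(l))%MM.
Proof.
rewrite /D raddf_sum /= big_mkcondr /=; apply: eq_bigr => l _.
by rewrite -mulrA mcoeff_sign mcoeff_mulX; case: ifP => //; rewrite mulr0.
Qed.

Let sgE l S : koszul_sign l S = (sg l S)%:MP.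
Proof. by rewrite /koszul_sign /sg rmorphXn /= rmorphN1. Qed.

Let sg_U l m T : m \notin T -> sg l (m |: T) = (-1) ^+ (m < l)%N * sg l T.
Proof.
move=> mT; rewrite /sg -exprD; congr (_ ^+ _).
case: ltnP => ml /=.
  have -> : [set x in m |: T | (x < l)%N] = m |: [set x in T | (x < l)%N].
    by apply/setP => x; rewrite !inE; case: eqP => [->|] //=; rewrite ml.
  by rewrite cardsU1 inE (negPf mT).
apply: eq_card => x; rewrite !inE; case: eqP => [->|] //=.
by rewrite ltnNge ml andbF.
Qed.

Let sign_U l m T : m \notin T ->
  koszul_sign l (m |: T) = (-1) ^+ (m < l)%N * koszul_sign l T.
Proof. by move=> mT; rewrite !sgE sg_U // mpolyCM rmorphXn /= rmorphN1. Qed.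

Let DD G T : D (D G) T = 0.
Proof.
pose E (l m : 'I_n) : R := koszul_sign l T * koszul_sign m T * ('X_l * 'X_m)
            * G (l |: (m |: T)).
pose P (l m : 'I_n) := (l \notin T) && (m \notin T).
have -> : D (D G) T =
    \sum_l \sum_(m | P l m && (l < m)%N) - E l m
  + \sum_l \sum_(m | P l m && (m < l)%N) E l m.
  rewrite -big_split /= /D big_mkcond; apply: eq_bigr => l _.
  rewrite /P; case: ifP => /= lT; last first.
    by rewrite !big_pred0 ?addr0 // => m; rewrite lT.
  rewrite mulr_sumr (bigID (fun m => (l < m)%N)) /=; congr (_ + _).
    apply: eq_big => [m|m /andP[mT lm]].
      rewrite !inE negb_or; case: ltngtP => //= lm; last by rewrite !andbF.
        by rewrite !andbT /=; case: eqP lm => // ->; rewrite ltnn.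
      by rewrite !andbF.
    rewrite sign_U // lm expr1 mulN1r !mulNr mulrN; congr (- _).
    rewrite /E [m |: (_ |: _)]setUCA -!mulrA; congr (_ * _).
    by rewrite mulrCA.
  apply: eq_big => [m|m /andP[mT lm]].
    rewrite !inE negb_or -leqNgt; case: eqP => [->|/eqP ml] /=.
      by rewrite ltnn andbF.
    by rewrite [in RHS]ltn_neqAle ml.
  move: mT; rewrite !inE negb_or => /andP[ml mT].
  rewrite sign_U // (negPf lm) expr0 mul1r.
  rewrite /E [m |: (_ |: _)]setUCA -!mulrA; congr (_ * _).
  by rewrite mulrCA.
rewrite [X in X + _](exchange_big_dep xpredT) //= -big_split big1 //= => m _.
rewrite (eq_bigl (fun l => P m l && (l < m)%N)) => [|l]; last first.
  by rewrite /P [(l \notin T) && _]andbC.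
rewrite -big_split big1 //= => l _; apply/eqP; rewrite addrC subr_eq0; apply/eqP.
rewrite /E setUCA; congr (_ * _ * _); last by rewrite mulrC.
by rewrite mulrC.
Qed.

(* The contracting homotopy: on x^u e_T, with l the least index in T or in the
   support of u, it is x^(u - e_l) e_(T + l) if l is not in T, and 0 if it is. *)
Let low l (u : 'X_{1..n}) := [forall m : 'I_n, (m < l)%N ==> (u m == 0%N)].

Let q l (p : R) : R :=
  \sum_(u <- msupp p | (0 < u l)%N && low l u) p@_u *: 'X_[u - U_(l)].

Let mcoeff_q l p v :
  (q l p)@_v = if low l v then p@_(v + U_(l))%MM else 0.
Proof.
have lowD : low l (v + U_(l))%MM = low l v.
  apply: eq_forallb => m; rewrite mnmDE mnm1E.
  case: ltnP => //= ml; rewrite (_ : l == m = false) ?addn0 //.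
  by apply/eqP => E; rewrite E ltnn in ml.
rewrite /q raddf_sum /=.
rewrite (eq_bigr (fun u => if u == (v + U_(l))%MM then p@_u else 0)); last first.
  move=> u /andP[ul _]; rewrite mcoeffZ mcoeffX.
  have uK : (u - U_(l) + U_(l))%MM = u.
    by rewrite submK //; apply/mnm_lepP => j; rewrite mnm1E; case: eqP => [<-|].
  case: (u =P _) => [->|ne]; first by rewrite addmK eqxx mulr1.
  by case: eqP => [E|]; rewrite ?mulr0 //; case: ne; rewrite -E uK.
rewrite -big_mkcondr /=.
have [vs|vs] := boolP ((v + U_(l))%MM \in msupp p); last first.
  rewrite (memN_msupp_eq0 vs) if_same big_seq_cond big1 // => u.
  by case/and3P => us _ /eqP E; rewrite -E us in vs.
case: ifP => lv; last first.
  by rewrite big1 // => u /andP[/andP[_ lu] /eqP E]; rewrite E lowD lv in lu.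
rewrite big_mkcond (bigD1_seq (v + U_(l))%MM) ?msupp_uniq //=.
rewrite lowD lv eqxx mnmDE mnm1E eqxx addn1 /= big1 ?addr0 // => u /negPf->.
by rewrite andbF.
Qed.

Let H G S : R :=
  if [pick l in S | [forall m in S, (l <= m)%N]] is Some l
  then q l (G (S :\ l)) else 0.

Let H_min G S l : l \in S -> (forall m, m \in S -> (l <= m)%N) ->
  H G S = q l (G (S :\ l)).
Proof.
move=> lS lmin; rewrite /H; case: pickP => [m /andP[mS /forall_inP mmin]|].
  suff -> : m = l by [].
  by apply/val_inj/eqP; rewrite eqn_leq lmin // mmin.
by move/(_ l); rewrite lS /=; case/forall_inP.
Qed.


Let ltn_ne l m : (l <= m)%N -> m != l -> (l < m)%N.
Proof. by move=> lm ne; rewrite ltn_neqAle lm andbT eq_sym. Qed.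

Let DH G T u : (forall S, D G S = 0) -> (T != set0) || (u != 0%MM) ->
  (D (H G) T)@_u = (G T)@_u.
Proof.
move=> DG0 nz.
have [l0 /andP[l0in /forall_inP l0min]] :
  exists l, ((l \in T) || (0 < u l)%N)
    && [forall (m | (m \in T) || (0 < u m)%N), (l <= m)%N].
  pose A l := (l \in T) || (0 < u l)%N.
  have [l Al] : exists l, A l.
    case/orP: nz => [/set0Pn[l lT]|nz]; first by exists l; rewrite /A lT.
    apply/existsP; apply: contraNT nz => /existsPn nA; apply/eqP/mnmP => l.
    by rewrite mnm0E; have := nA l; rewrite /A negb_or lt0n negbK => /andP[_ /eqP].
  exists [arg min_(i < l | A i) i]; case: arg_minnP => // m Am mmin.
  by rewrite [_ || _]Am /=; apply/forall_inP => j /mmin.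
have l0T m : m \in T -> (l0 <= m)%N by move=> mT; apply: l0min; rewrite mT.
have l0u m : (0 < u m)%N -> (l0 <= m)%N.
  by move=> mu; apply: l0min; rewrite mu orbT.
have sg1 S : (forall m, m \in S -> (l0 <= m)%N) -> sg l0 S = 1.
  move=> Smin; rewrite /sg (_ : #|_| = 0%N) //; apply/eqP; rewrite cards_eq0.
  apply/eqP/setP => m; rewrite !inE; apply/negP => /andP[/Smin].
  by rewrite leqNgt => /negP.
have lowu l : (l <= l0)%N -> low l u.
  move=> ll0; apply/forall_inP => m ml; rewrite -leqn0 leqNgt; apply/negP.
  by move/l0u; rewrite leqNgt (leq_trans ml).
have [l0inT|l0nT] := boolP (l0 \in T); last first.
  have ul0 : (0 < u l0)%N by move: l0in; rewrite (negPf l0nT).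
  rewrite mcoeffD_ (bigD1 l0) /=; last by rewrite l0nT.
  rewrite sg1 // mul1r (@H_min _ _ l0) ?setU11 // => [|m]; last first.
    by rewrite !inE => /orP[/eqP->|/l0T].
  rewrite mcoeff_q setU1K // submK; last first.
    by apply/mnm_lepP => j; rewrite mnm1E; case: eqP => [<-|].
  have -> : low l0 (u - U_(l0))%MM.
    apply/forall_inP => m ml; rewrite mnmBE.
    by have /forall_inP/(_ m ml)/eqP-> := lowu _ (leqnn l0).
  rewrite big1 ?addr0 // => l /andP[/andP[lT ul] ll0].
  rewrite /H; case: pickP => [m /andP[mlT _]|_]; last by rewrite mcoeff0 mulr0.
  rewrite mcoeff_q; case: ifP; last by rewrite mulr0.
  have ml0 : (l0 < m)%N.
    have ne : m != l0.
      by apply: contraTneq mlT => ->; rewrite !inE eq_sym negb_or ll0.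
    apply: ltn_ne ne.
    by move: mlT; rewrite !inE => /orP[/eqP->|/l0T //]; apply: l0u.
  move/forall_inP/(_ _ ml0); rewrite mnmBE mnm1E (negPf ll0) subn0.
  by rewrite eqn0Ngt ul0.
have /(congr1 (mcoeff (u + U_(l0))%MM)) := DG0 (T :\ l0).
rewrite mcoeff0 mcoeffD_ (bigD1 l0) /=; last first.
  by rewrite !inE eqxx /= mnmDE mnm1E eqxx addn1.
rewrite sg1 => [|m]; last by rewrite !inE => /andP[_ /l0T].
rewrite mul1r addmK setD1K // => /eqP; rewrite addr_eq0 => /eqP->.
rewrite mcoeffD_ -sumrN; apply: eq_big => [l|l /andP[lT ul]].
  rewrite !inE negb_and negbK mnmDE mnm1E.
  case: (l =P l0) => [->|/eqP ne]; first by rewrite l0inT andbF.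
  by rewrite [l0 == l]eq_sym (negPf ne) addn0 andbT.
have ll0 : l != l0 by apply: contraNneq lT => ->.
rewrite (@H_min _ _ l0); last first.
- by move=> m; rewrite !inE => /orP[/eqP->|/l0T //]; apply: l0u.
- by rewrite !inE l0inT orbT.
rewrite mcoeff_q.
have -> : low l0 (u - U_(l))%MM.
  apply/forall_inP => m ml; rewrite mnmBE.
  by have /forall_inP/(_ m ml)/eqP-> := lowu _ (leqnn l0).
have -> : (l |: T) :\ l0 = l |: (T :\ l0).
  by apply/setP => m; rewrite !inE; case: (m =P l) => [->|]; rewrite ?ll0.
have lU : (U_(l) <= u)%MM.
  by apply/mnm_lepP => j; rewrite mnm1E; case: eqP => [<-|].
have -> : (u + U_(l0) - U_(l) = u - U_(l) + U_(l0))%MM.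
  apply/mnmP => j; rewrite !(mnmBE, mnmDE) addnBAC //.
  exact: (mnm_lepP lU j).
rewrite -mulNr; congr (_ * _).
rewrite -{1}(setD1K l0inT) sg_U ?setD11 //.
have -> : (l0 < l)%N by apply: ltn_ne ll0; apply: l0u.
by rewrite expr1 mulN1r.
Qed.

Let ext i (g : free_mod koszul i) S : R :=
  if insub S is Some a then g a else 0.

Let restr i G : free_mod koszul i := [ffun a => G (val a)].

Let ext_val i (g : free_mod koszul i) a : ext g (val a) = g a.
Proof. by rewrite /ext valK. Qed.

Let ext_supp i (g : free_mod koszul i) S : #|S| != i -> ext g S = 0.
Proof. by move=> /negPf Si; rewrite /ext insubF. Qed.

Let fdiffE i (g : free_mod koszul i.+1) b : fdiff g b = D (ext g) (val b).
Proof.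
rewrite ffunE /= /koszul_dif.
under eq_bigr do rewrite mulr_sumr.
rewrite (exchange_big_dep xpredT) //= /D [RHS]big_mkcond /=.
apply: eq_bigr => l _; case: ifPn => [lb|/negPn lb]; last first.
  rewrite big_pred0 // => a; apply/negP => /andP[_ /eqP E].
  by move: lb; rewrite E setD11.
have ci : #|l |: val b| == i.+1 by rewrite cardsU1 lb (eqP (valP b)).
rewrite (big_pred1 (Sub (l |: val b) ci)) => [|a].
  by rewrite -ext_val SubK sign_U // ltnn expr0 mul1r mulrC.
rewrite /= -[a == _](inj_eq val_inj) SubK; apply/andP/eqP => [[la /eqP->]|->].
  by rewrite setD1K.
by rewrite setU11 setU1K.
Qed.

Let D_ext G i : (forall S, #|S| != i -> G S = 0) ->
  forall g : free_mod koszul i, (forall a, g a = G (val a)) -> ext g =1 G.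
Proof.
move=> Gi g gE S; rewrite /ext; case: insubP => [a _ <-|/Gi->] //.
Qed.

Let eq_D G G' T : G =1 G' -> D G T = D G' T.
Proof. by move=> E; apply: eq_bigr => l _; rewrite E. Qed.

Let fdiff_fdiff i (h : free_mod koszul i.+2) : fdiff (fdiff h) = 0.
Proof.
apply/ffunP => b; rewrite fdiffE ffunE -[RHS](DD (ext h) (val b)).
apply: eq_D; apply: D_ext => [S Si|a]; last by rewrite fdiffE.
rewrite /D big1 // => l lS; rewrite ext_supp ?mulr0 //.
by rewrite cardsU1 lS eqSS.
Qed.

Let lift_cycle i (g : free_mod koszul i) :
    (forall S, D (ext g) S = 0) -> (i = 0%N -> (ext g set0)@_0%MM = 0) ->
  exists h, g = fdiff h.
Proof.
move=> Dg g0; exists (restr i.+1 (H (ext g))).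
apply/ffunP => b; rewrite fdiffE -(ext_val g b).
transitivity (D (H (ext g)) (val b)).
  apply/mpolyP => u; case: (boolP ((val b != set0) || (u != 0%MM))) => [nz|].
    by rewrite DH.
  rewrite negb_or !negbK => /andP[/eqP b0 /eqP->].
  have i0 : i = 0%N by rewrite -(eqP (valP b)) b0 cards0.
  rewrite b0 g0 // mcoeffD_ big_pred0 // => l.
  by rewrite mnm0E ltnn andbF.
symmetry; apply: eq_D; apply: D_ext => [S Si|a]; last by rewrite ffunE.
rewrite /H; case: pickP => // l /andP[lS _].
rewrite ext_supp.
  rewrite /q msupp0 big_nil //.
by apply: contra Si; rewrite (cardsD1 l S) lS => /eqP->.
Qed.

Theorem koszul_resolution : graded_free_resolution_of_k koszul.
Proof.
have c0 : #|set0 : {set 'I_n}| == 0%N by rewrite cards0.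
have e0 (g : free_mod koszul 0) : ext g set0 = g (Sub set0 c0).
  by rewrite -ext_val SubK.
have augE (g : free_mod koszul 0) : augment g = (ext g set0)@_0%MM.
  rewrite /augment (big_pred1 (Sub set0 c0)) => [|a].
    by rewrite mulr1 -ext_val SubK.
  by rewrite /= -[a == _](inj_eq val_inj) SubK -cards_eq0 (valP a).
have ext0 (g : free_mod koszul 0) S : D (ext g) S = 0.
  rewrite /D big1 // => l lS; rewrite ext_supp ?mulr0 //.
  by rewrite cardsU1 lS.
split=> [i a b m|b _|c|g|i g] //=.
- rewrite mcoeff_msupp /koszul_dif raddf_sum /= => nz.
  suff -> : mdeg m = 1%N by [].
  apply/eqP; apply: contraNT nz => m1; rewrite big1 // => l _.
  rewrite mcoeff_sign mcoeffX; case: eqP => [E|]; last by rewrite mulr0.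
  by rewrite -E mdeg1 in m1.
- exists [ffun=> c%:MP]; rewrite augE.
  by rewrite e0 ffunE mcoeffC eqxx mulr1.
- split=> [|[h ->]]; first by rewrite augE => g0; apply: lift_cycle.
  by rewrite augE e0 fdiffE SubK mcoeffD_
    big_pred0 // => l; rewrite mnm0E ltnn andbF.
- split=> [dg0|[h ->]]; last exact: fdiff_fdiff.
  apply: lift_cycle => // S; have [Si|Si] := boolP (#|S| == i).
    have := congr1 (fun f : free_mod koszul i => f (Sub S Si)) dg0.
    by rewrite fdiffE SubK ffunE.
  rewrite /D big1 // => l lS; rewrite ext_supp ?mulr0 //.
  by rewrite cardsU1 lS eqSS.
Qed.

End Koszul.

(* dim_k Tor_i^R(R/I, k)_j, computed from the Koszul resolution of k. *)
Definition betti (k : fieldType) (n : nat) (I : {mpoly k[n]} -> Prop)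
    (i j : nat) : nat :=
  tor_dim (koszul k n) I i j.

(* The lex plus powers conjecture for socles, over a fixed R = k[x_1, ..., x_n]. *)
Definition lpp_socle_conjecture (k : fieldType) (n : nat) : Prop :=
  forall (b : 'I_n -> nat) (M J : {mpoly k[n]} -> Prop),
    degree_list b ->
    lex_plus_powers b M ->
    homogeneous_ideal J ->
    contains_regular_sequence b J ->
    (forall d, hilbert M d = hilbert J d) ->
    forall j, (betti J n j <= betti M n j)%N.

(* Main.v *)
Require Import Defs.
From mathcomp Require Import all_boot all_order all_algebra.
From Stdlib Require Import Classical ClassicalEpsilon.

(** Let [F] be the ideal of the regular sequence in [I], and [X] the ideal of
    the powers [x_i^a_i]. They have the same Hilbert function
    ([hdim_partial_ideal_degrees]). Write [R_1 V] for the span of the products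
    of the variables with the elements of [V].

    Suppose that [I] has more minimal generators than [L] in degree [t + 1].
    Their number is [dim I_(t+1) - dim R_1 I_t] ([betti1P]), so
    [dim R_1 I_t < dim R_1 L_t]. The inequality survives when the degree [t + 1]
    generators of [F] and of [X] are added on the two sides, because the powers
    are minimal generators of [L], each of which raises the dimension on the
    right by one ([hdim_with_generators_le], [hdim_with_pure_powers]). In
    particular the space on the right contains monomials outside of [X]; let
    [m0 = x_l u0], with [u0] in [L_t], be the lexicographically last one.

    The conjecture is applied to two modifications of [L] and [I]. The ideal
    [M] is [X] in degrees at most [t], is spanned in degree [t + 1] by [X] and
    the monomials larger than [m0], and is [L] above; it is again lex plus
    powers for the same exponents ([lex_truncation_lpp]), and passing from
    [R_1 L_t + X_(t+1)] to [M_(t+1)] loses at most the dimension of [m0]. Hence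
    there is a space [W] of dimension [dim M_(t+1)] between
    [R_1 I_t + F_(t+1)] and [I_(t+1)]. The ideal [J] is [F] in degrees at most
    [t], is [W] in degree [t + 1], and is [I] above
    ([ex_ideal_prescribed_dim]). So [J] contains the regular sequence of [I] and
    has the Hilbert function of [M].

    The last Betti numbers count socle elements ([betti_topP]). In degree [t]
    the variables multiply all of [I_t] into [W]. On the other hand a form of
    degree [t] which the variables multiply into [M] lies in [L_t] and does not
    involve [u0] ([lex_truncation_colon]). As [J_t] and [M_t] have the same
    dimension, the conjecture gives [dim I_t < dim L_t], against the equality of
    the Hilbert functions. *)

Set Implicit Arguments.
Unset Strict Implicit.
Unset Printing Implicit Defensive.
Import Order.TTheory GRing.Theory.
Local Open Scope ring_scope.

(** * Dimensions of subquotients *)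

Section SubquotientDimension.
Variables (k : fieldType) (V : lmodType k).
Implicit Types (Z B C W : V -> Prop) (d e : nat).

Definition subspace Z := Z 0 /\ forall (c : k) p q, Z p -> Z q -> Z (c *: p + q).

Definition zerospace : V -> Prop := fun x => x = 0.

Lemma zerospaceP : subspace zerospace.
Proof. by split=> // c p q -> ->; rewrite scaler0 addr0. Qed.

Section Closure.
Variables (Z : V -> Prop) (ZP : subspace Z).

Lemma subspaceD p q : Z p -> Z q -> Z (p + q).
Proof. by move=> Zp Zq; rewrite -[p]scale1r; apply: ZP.2. Qed.

Lemma subspaceZ c p : Z p -> Z (c *: p).
Proof. by move=> Zp; rewrite -[_ *: _]addr0; apply: ZP.2 => //; apply: ZP.1. Qed.

Lemma subspaceN p : Z p -> Z (- p).
Proof. by move=> Zp; rewrite -scaleN1r; apply: subspaceZ. Qed.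

Lemma subspaceB p q : Z p -> Z q -> Z (p - q).
Proof. by move=> Zp Zq; apply: subspaceD => //; apply: subspaceN. Qed.

Lemma subspace_sum (T : Type) (r : seq T) (P : pred T) (F : T -> V) :
  (forall i, P i -> Z (F i)) -> Z (\sum_(i <- r | P i) F i).
Proof.
by move=> ZF; apply: big_ind => //; [apply: ZP.1|apply: subspaceD].
Qed.

Lemma subspace_lincomb d (c : 'I_d -> k) (v : 'I_d -> V) :
  (forall i, Z (v i)) -> Z (\sum_i c i *: v i).
Proof. by move=> Zv; apply: subspace_sum => i _; apply: subspaceZ. Qed.

End Closure.

Lemma subspaceI Z W : subspace Z -> subspace W -> subspace (fun p => Z p /\ W p).
Proof.
move=> ZP WP; split=> [|c p q [Zp Wp] [Zq Wq]]; first by split; [apply: ZP.1|apply: WP.1].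
by split; [apply: ZP.2|apply: WP.2].
Qed.

Definition independent d B (v : 'I_d -> V) :=
  forall c : 'I_d -> k, B (\sum_i c i *: v i) -> forall i, c i = 0.

(** Steinitz exchange: if the coefficient matrix had more rows than columns, a
    vector of its left kernel would be a relation among the [v i] modulo [B]. *)
Lemma independent_le_spanning d e B (v : 'I_d -> V) (w : 'I_e -> V) :
    subspace B -> independent B v ->
    (forall i, exists c : 'I_e -> k, B (v i - \sum_j c j *: w j)) ->
  (d <= e)%N.
Proof.
move=> BP vB /fin_all_exists[C CE].
pose A : 'M[k]_(d, e) := \matrix_(i, j) C i j.
rewrite leqNgt; apply/negP => lt_ed.
have : kermx A != 0.
  by rewrite -mxrank_eq0 mxrank_ker subn_eq0 -ltnNge (leq_ltn_trans (rank_leq_col A)).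
case/rowV0Pn => r /sub_kermxP rA /eqP[]; apply/rowP => i; rewrite mxE.
apply: (vB (r 0)).
suff -> : \sum_i r 0 i *: v i = \sum_i r 0 i *: (v i - \sum_j C i j *: w j).
  by apply: subspace_lincomb.
under [RHS]eq_bigr do rewrite scalerBr.
rewrite sumrB [X in _ - X](_ : _ = 0) ?subr0 //.
under eq_bigr do rewrite scaler_sumr.
rewrite exchange_big big1 //= => j _.
under eq_bigr do rewrite scalerA.
rewrite -scaler_suml (_ : \sum_i _ = 0) ?scale0r //.
transitivity ((r *m A) 0 j); last by rewrite rA mxE.
by rewrite mxE; apply: eq_bigr => l _; rewrite mxE.
Qed.

Lemma is_qdim_le Z Z' B d d' : subspace B -> (forall z, Z z -> Z' z) ->
  is_qdim Z B d -> is_qdim Z' B d' -> (d <= d')%N.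
Proof.
move=> BP ZZ' [v [Zv vB _]] [w [_ _ w_span]].
by apply: (independent_le_spanning BP vB) => i; apply/w_span/ZZ'.
Qed.

Lemma is_qdim_uniq Z B d d' : subspace B ->
  is_qdim Z B d -> is_qdim Z B d' -> d = d'.
Proof.
move=> BP Zd Zd'; apply/eqP; rewrite eqn_leq.
by rewrite !(is_qdim_le BP _ Zd Zd', is_qdim_le BP _ Zd' Zd).
Qed.

Lemma is_qdim_qdim Z B d : subspace B -> is_qdim Z B d -> qdim Z B = d.
Proof.
move=> BP Zd; apply: (is_qdim_uniq BP _ Zd).
by apply: epsilon_spec; exists d.
Qed.

Lemma qdimP Z B d : is_qdim Z B d -> is_qdim Z B (qdim Z B).
Proof. by move=> Zd; apply: epsilon_spec; exists d. Qed.

Definition extend_family d (v : 'I_d -> V) (z : V) : 'I_d.+1 -> V :=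
  fun i => if unlift ord_max i is Some j then v j else z.

Lemma sum_extend_family d (v : 'I_d -> V) z (c : 'I_d.+1 -> k) :
  \sum_i c i *: extend_family v z i =
  \sum_i c (lift ord_max i) *: v i + c ord_max *: z.
Proof.
rewrite big_ord_recr /= /extend_family unlift_none; congr (_ + _).
apply: eq_bigr => i _.
have -> : widen_ord (leqnSn d) i = lift ord_max i.
  by apply: val_inj; rewrite /= /bump leqNgt ltn_ord.
by rewrite liftK.
Qed.

(** A relation with a nonzero coefficient at [z] could be solved for [z]. *)
Lemma independent_extend_family d B (v : 'I_d -> V) z : subspace B -> independent B v ->
    ~ (exists c : 'I_d -> k, B (z - \sum_i c i *: v i)) ->
  independent B (extend_family v z).
Proof.
move=> BP vB zv c; rewrite sum_extend_family => Bc.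
have c0 : c ord_max = 0.
  apply/eqP; apply: contra_notT zv => c_neq0.
  exists (fun i => - ((c ord_max)^-1 * c (lift ord_max i))).
  have := subspaceZ BP (c ord_max)^-1 Bc.
  rewrite scalerDr scalerA mulVf // scale1r addrC scaler_sumr -sumrN.
  by congr (B (_ + _)); apply: eq_bigr => i _; rewrite scaleNr opprK scalerA.
rewrite c0 scale0r addr0 in Bc.
by move=> i; case: (unliftP ord_max i) => [j ->|->]; rewrite ?c0 ?(vB _ Bc).
Qed.

(** Otherwise every independent family could be extended, beyond the bound that
    the spanning family [w] sets by exchange. *)
Lemma ex_is_qdim e (w : 'I_e -> V) Z B : subspace B ->
    (forall z, Z z -> exists c : 'I_e -> k, z = \sum_i c i *: w i) ->
  exists d, is_qdim Z B d.
Proof.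
move=> BP w_span; apply: NNPP => no_d.
have [v [Zv vB]] : exists v : 'I_e.+1 -> V, (forall i, Z (v i)) /\ independent B v.
  elim: {w w_span} e.+1 => [|d [v [Zv vB]]]; first by exists (fun _ => 0); split=> [[]|c _ []].
  have [z nz] : exists z, ~ (Z z -> exists c : 'I_d -> k, B (z - \sum_i c i *: v i)).
    by apply: not_all_ex_not => v_span; apply: no_d; exists d, v; split.
  have [Zz zv] := imply_to_and _ _ nz.
  exists (extend_family v z); split; last exact: independent_extend_family.
  by move=> i; rewrite /extend_family; case: unlift.
have: (e < e)%N; last by rewrite ltnn.
apply: (independent_le_spanning BP vB (w := w)) => i.
by have [c ->] := w_span _ (Zv i); exists c; rewrite subrr; apply: BP.1.
Qed.

Lemma is_qdim_add Z C B d e : subspace B -> subspace C ->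
    (forall x, B x -> C x) -> (forall x, C x -> Z x) ->
  is_qdim C B e -> is_qdim Z C d -> is_qdim Z B (e + d).
Proof.
move=> BP CP BC CZ [v [Cv vB v_span]] [w [Zw wC w_span]].
exists (fun i => match split i with inl j => v j | inr j => w j end).
have sumE (c : 'I_(e + d) -> k) :
    \sum_i c i *: match split i with inl j => v j | inr j => w j end =
    \sum_i c (lshift d i) *: v i + \sum_i c (rshift e i) *: w i.
  rewrite big_split_ord; congr (_ + _); apply: eq_bigr => i _.
    by rewrite (unsplitK (inl i)).
  by rewrite (unsplitK (inr i)).
split=> [i|c|z Zz].
- by case: split => j //; apply: CZ.
- rewrite sumE => Bc.
  have c_w : forall i, c (rshift e i) = 0.
    apply: (wC (fun i => c (rshift e i))).
    by rewrite -[X in C X](addKr (\sum_i c (lshift d i) *: v i)) addrC;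
      apply: (subspaceB CP); [apply: BC|apply: subspace_lincomb].
  have c_v : forall i, c (lshift d i) = 0.
    apply: (vB (fun i => c (lshift d i))); move: Bc.
    by rewrite [X in _ + X]big1 ?addr0 // => i _; rewrite c_w scale0r.
  by move=> i; rewrite -(splitK i); case: (split i) => j /=.
- have [c Cz] := w_span z Zz; have [b Bz] := v_span _ Cz.
  exists (fun i => match split i with inl j => b j | inr j => c j end).
  rewrite sumE (eq_bigr (fun i => b i *: v i)); last first.
    by move=> i _; rewrite (unsplitK (inl i)).
  rewrite [X in _ - (_ + X)](eq_bigr (fun i => c i *: w i)); last first.
    by move=> i _; rewrite (unsplitK (inr i)).
  by rewrite [X in _ - X]addrC opprD addrA.
Qed.

Lemma is_qdim_lt Z Z' B d d' z : subspace B -> subspace Z ->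
    (forall x, B x -> Z x) -> (forall x, Z x -> Z' x) -> Z' z -> ~ Z z ->
  is_qdim Z B d -> is_qdim Z' B d' -> (d < d')%N.
Proof.
move=> BP ZP BZ ZZ' Z'z nZz [v [Zv vB _]] [w [_ _ w_span]].
have sB : independent B (extend_family v z).
  apply: independent_extend_family => // -[c Bc]; apply: nZz.
  by rewrite -[z](subrK (\sum_i c i *: v i));
    apply: (subspaceD ZP); [apply: BZ|apply: subspace_lincomb].
apply: (independent_le_spanning BP sB) => i; apply: w_span.
by rewrite /extend_family; case: unlift => [j|//]; apply: ZZ'.
Qed.

(** The inclusion of [Z] in [Z' + k z] costs at most one dimension. *)
Lemma is_qdim_leS Z Z' B d d' z : subspace B ->
    (forall x, Z x -> exists c, Z' (x - c *: z)) ->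
  is_qdim Z B d -> is_qdim Z' B d' -> (d <= d'.+1)%N.
Proof.
move=> BP ZZ' [v [Zv vB _]] [w [_ _ w_span]].
apply: (independent_le_spanning BP vB (w := extend_family w z)) => i.
have [c /w_span[b Bb]] := ZZ' _ (Zv i).
exists (fun j => if unlift ord_max j is Some l then b l else c).
rewrite sum_extend_family unlift_none; under eq_bigr do rewrite liftK.
by rewrite [X in _ - X]addrC opprD addrA.
Qed.

(** Vectors of [Q] are added to [P] one at a time. *)
Lemma ex_subspace_between P Q d w e : subspace P -> subspace Q ->
    (forall x, P x -> Q x) ->
    is_qdim P zerospace d -> is_qdim Q zerospace e -> (d <= w <= e)%N ->
  exists W, [/\ subspace W, forall x, P x -> W x, forall x, W x -> Q x
                & is_qdim W zerospace w].
Proof.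
move=> PP QP PQ Pd Qe /andP[]; elim: w => [|w IHw].
  by rewrite leqn0 => /eqP d0 _; exists P; rewrite -d0; split.
rewrite leq_eqVlt => /orP[/eqP <- _|]; first by exists P; split.
rewrite ltnS => dw we; have [W [WP PW WQ [v [Wv v0 v_span]]]] := IHw dw (ltnW we).
have [z nz] : exists z, ~ (Q z -> W z).
  apply: not_all_ex_not => QW; 
  have := is_qdim_le zerospaceP QW Qe (ex_intro _ v (And3 Wv v0 v_span)).
  by rewrite leqNgt we.
have [Qz Wz] := imply_to_and _ _ nz.
exists (fun x => exists c, W (x - c *: z)); split.
- split=> [|c p q [a Wa] [b Wb]]; first by exists 0; rewrite scale0r subr0; apply: WP.1.
  exists (c * a + b); have := WP.2 c _ _ Wa Wb.
  by rewrite scalerBr scalerA scalerDl opprD !addrA;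
     congr W; rewrite -!addrA; congr (_ + _); rewrite addrCA.
- by move=> x Px; exists 0; rewrite scale0r subr0; apply: PW.
- move=> x [c Wc]; rewrite -[x](subrK (c *: z)); apply: (subspaceD QP); first exact: WQ.
  exact: subspaceZ.
exists (extend_family v z); split.
- move=> i; rewrite /extend_family; case: unlift => [j|].
    by exists 0; rewrite scale0r subr0.
  by exists 1; rewrite scale1r subrr; apply: WP.1.
- apply: (independent_extend_family zerospaceP) => // -[c]; move/(subr0_eq) => zE.
  by apply: Wz; rewrite zE; apply: subspace_lincomb.
- move=> x [c /v_span[b xb]].
  exists (fun j => if unlift ord_max j is Some l then b l else c).
  rewrite sum_extend_family unlift_none; under eq_bigr do rewrite liftK.
  by rewrite [X in _ - X]addrC opprD addrA.
Qed.

Lemma eq_is_qdim Z Z' B B' d :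
    (forall x, Z x <-> Z' x) -> (forall x, Z x -> (B x <-> B' x)) -> subspace Z ->
  is_qdim Z B d -> is_qdim Z' B' d.
Proof.
move=> ZZ' BB' ZP [v [Zv vB v_span]]; exists v; split=> [i|c B'c|z /ZZ' Zz].
- exact/ZZ'.
- by apply/vB/BB' => //; apply: subspace_lincomb.
- have [c Bc] := v_span z Zz; exists c; apply/BB' => //.
  by apply: (subspaceB ZP) => //; apply: subspace_lincomb.
Qed.

End SubquotientDimension.

Section SubquotientMap.
Variables (k : fieldType) (V V' : lmodType k) (phi : V -> V').
Variables (Z B : V -> Prop) (Z' B' : V' -> Prop).
Hypotheses (phi_lin : linear phi) (ZP : subspace Z) (B'P : subspace B').
Hypotheses (ZZ' : forall z, Z z -> Z' (phi z)).
Hypotheses (BB' : forall z, Z z -> (B z <-> B' (phi z))).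
Hypothesis phi_surj : forall z', Z' z' -> exists z, Z z /\ B' (z' - phi z).

Let phiB p q : phi (p - q) = phi p - phi q.
Proof. by rewrite addrC -scaleN1r phi_lin scaleN1r addrC. Qed.

Let phi_lincomb d (c : 'I_d -> k) (v : 'I_d -> V) :
  phi (\sum_i c i *: v i) = \sum_i c i *: phi (v i).
Proof.
elim/big_rec2: _ => [|i y x _ <-]; last exact: phi_lin.
by rewrite -[0 in LHS](subrr 0) phiB subrr.
Qed.

Lemma is_qdim_image d : is_qdim Z B d -> is_qdim Z' B' d.
Proof.
move=> [v [Zv vB v_span]]; exists (phi \o v).
split=> [i|c|z' /phi_surj[z [Zz B'z]]].
- exact: ZZ'.
- rewrite -phi_lincomb => B'c; apply/vB/BB' => //; exact: subspace_lincomb.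
have [c Bc] := v_span z Zz; exists c; rewrite -phi_lincomb.
rewrite -[z'](subrK (phi z)) -addrA -phiB; apply: (subspaceD B'P) => //.
by apply/BB' => //; apply: (subspaceB ZP) => //; apply: subspace_lincomb.
Qed.

Lemma is_qdim_preimage d : is_qdim Z' B' d -> is_qdim Z B d.
Proof.
move=> [v' [Z'v' v'B' v'_span]].
have [v vP] := fin_all_exists (fun i => phi_surj (Z'v' i)).
have Zv i : Z (v i) by case: (vP i).
have B'sum (c : 'I_d -> k) :
    B' (\sum_i c i *: v' i - phi (\sum_i c i *: v i)).
  rewrite phi_lincomb -sumrB; apply: subspace_sum => // i _.
  by rewrite -scalerBr; apply: subspaceZ => //; case: (vP i).
exists v; split=> // [c|z Zz].
  move=> Bc; apply: v'B'.
  rewrite -[\sum_i _](subrK (phi (\sum_i c i *: v i))); apply: (subspaceD B'P) => //.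
  by apply/BB' => //; apply: subspace_lincomb.
have [c B'c] := v'_span _ (ZZ' Zz); exists c.
apply/BB'; first by apply: (subspaceB ZP) => //; apply: subspace_lincomb.
rewrite phiB -[phi z](subrK (\sum_i c i *: v' i)) -addrA.
exact: (subspaceD B'P).
Qed.

End SubquotientMap.

(** * Homogeneous components *)

Section HomogeneousComponents.
Variables (k : fieldType) (n : nat).
Local Notation R := {mpoly k[n]}.
Implicit Types (I J Z B : R -> Prop) (p q : R) (m : 'X_{1..n}).

Lemma mcoeff_pihomog d p m : (pihomog mdeg d p)@_m = if mdeg m == d then p@_m else 0.
Proof.
rewrite pihomogE raddf_sum /= (eq_bigr (fun u => if u == m then p@_u else 0)); last first.
  by move=> u _; rewrite mcoeffZ mcoeffX; case: eqP => _; rewrite ?mulr1 ?mulr0.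
rewrite -big_mkcondr /=; have [mp|mp] := boolP (m \in msupp p); last first.
  rewrite (memN_msupp_eq0 mp) if_same big_seq_cond big1 // => u.
  by case/and3P => up _ /eqP um; rewrite -um up in mp.
rewrite big_mkcond (bigD1_seq m) ?msupp_uniq //= eqxx andbT.
by rewrite big1 ?addr0 // => u /negPf ->; rewrite andbF.
Qed.

Lemma mcoeff_mulX_add p m u : ('X_[u] * p)@_(u + m) = p@_m.
Proof. by rewrite mulrC mcoeffMX. Qed.

Lemma mcoeff_mulX_eq0 p m u : ~~ (u <= m)%MM -> ('X_[u] * p)@_m = 0.
Proof.
move=> um; apply/eqP; rewrite mcoeff_eq0; apply: contra um => /msuppM_le.
by case/allpairsP => -[v w] /= [+ _ ->]; rewrite msuppX inE => /eqP ->; apply: lem_addr.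
Qed.

Lemma pihomog_mulX d p u :
  pihomog mdeg (mdeg u + d) ('X_[u] * p) = 'X_[u] * pihomog mdeg d p.
Proof.
apply/mpolyP => m; rewrite mcoeff_pihomog.
have [um|um] := boolP (u <= m)%MM; last by rewrite !mcoeff_mulX_eq0 ?if_same.
rewrite -(submK um) addmC !mcoeff_mulX_add mcoeff_pihomog mdegD eqn_add2l.
by [].
Qed.

Lemma pihomog_mulX_lt d p u : (d < mdeg u)%N -> pihomog mdeg d ('X_[u] * p) = 0.
Proof.
move=> du; apply/mpolyP => m; rewrite mcoeff_pihomog mcoeff0.
case: eqP => // md; rewrite mcoeff_mulX_eq0 //; apply: contraTN du.
by move=> /submK mE; rewrite -leqNgt -md -mE mdegD leq_addl.
Qed.

Lemma ideal_subspace I : is_ideal I -> subspace I.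
Proof.
case=> I0 ID IM; split=> // c p q Ip Iq; apply: ID => //.
by rewrite -mul_mpolyC; apply: IM.
Qed.

Lemma subspace_homog d : subspace (fun p : R => p \is d.-homog).
Proof.
split=> [|c p q]; first exact: dhomog0.
by move=> ? ?; apply: dhomogD => //; apply: dhomogZ.
Qed.

Lemma homog_mulX l d p : p \is d.-homog -> 'X_l * p \is d.+1.-homog.
Proof.
move=> pd; rewrite -add1n; apply: dhomogM => //.
by rewrite dhomogX; apply/eqP/mdeg1.
Qed.

Definition piece I d p := p \is d.-homog /\ I p.

Lemma piece_subspace I d : subspace I -> subspace (piece I d).
Proof. exact/subspaceI/subspace_homog. Qed.

Definition concentrated d Z := forall p, Z p -> p \is d.-homog.

(** This is what gives a value to [qdim], which is unspecified for spaces of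
    infinite dimension: the monomials of degree at most [d] span. *)
Lemma is_qdim_homog d Z B : subspace B -> concentrated d Z -> is_qdim Z B (qdim Z B).
Proof.
move=> BP Zd.
pose T : finType := 'X_{1..n < d.+1}.
have [e] : exists e, is_qdim Z B e; last exact: qdimP.
apply: (ex_is_qdim (w := fun i : 'I_#|T| => ('X_[(enum_val i : T)] : R))) => // z.
move=> /Zd z_homog; exists (fun i => z@_(enum_val i : T)).
rewrite {1}[z](@mpolywE _ _ d.+1); last first.
  rewrite mmeasureE; apply/bigmax_leqP_seq => m mz _.
  by rewrite ltnS (dhomog_mf z_homog mz).
by rewrite (reindex (@enum_val T predT)) //; apply/onW_bij/enum_val_bij.
Qed.

Definition hdim Z : nat := qdim Z (@zerospace k R).

Lemma hdimP d Z : concentrated d Z -> is_qdim Z (@zerospace k R) (hdim Z).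
Proof. by apply: is_qdim_homog; apply: zerospaceP. Qed.

Lemma hdim_add d Z B : concentrated d Z -> subspace B -> (forall p, B p -> Z p) ->
  hdim Z = (hdim B + qdim Z B)%N.
Proof.
move=> Zd BP BZ; apply: (is_qdim_qdim (zerospaceP _)).
apply: (@is_qdim_add _ _ _ B) => //; first exact: zerospaceP.
- by move=> _ ->; apply: BP.1.
- by apply: (@hdimP d) => p /BZ/Zd.
- exact: (is_qdim_homog BP Zd).
Qed.

Lemma hdim_le d Z Z' : concentrated d Z' -> (forall p, Z p -> Z' p) ->
  (hdim Z <= hdim Z')%N.
Proof.
move=> Z'd ZZ'; apply: (is_qdim_le (zerospaceP _) ZZ'); last exact: (hdimP Z'd).
by apply: (@hdimP d) => p /ZZ'/Z'd.
Qed.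

Lemma hdim_lt d Z Z' p : concentrated d Z' -> subspace Z ->
  (forall q, Z q -> Z' q) -> Z' p -> ~ Z p -> (hdim Z < hdim Z')%N.
Proof.
move=> Z'd ZP ZZ' Z'p Zp; apply: (is_qdim_lt (zerospaceP _) ZP _ ZZ' Z'p Zp).
- by move=> _ ->; apply: ZP.1.
- by apply: (@hdimP d) => q /ZZ'/Z'd.
- exact: (hdimP Z'd).
Qed.

Lemma eq_hdim d Z Z' : concentrated d Z -> (forall p, Z p <-> Z' p) -> hdim Z = hdim Z'.
Proof.
move=> Zd ZZ'; apply/eqP; rewrite eqn_leq !(@hdim_le d) // => p /ZZ' //.
exact: Zd.
Qed.

Lemma hdim_homog I d : subspace I ->
  hdim (fun p => p \is d.-homog) = (hdim (piece I d) + hilbert I d)%N.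
Proof.
move=> IP; rewrite (@hdim_add d _ (piece I d)) //; last by move=> p [].
  congr (_ + _)%N; apply: (is_qdim_qdim (piece_subspace d IP)).
  apply: (@eq_is_qdim _ _ (fun p => p \is d.-homog) _ I) => //.
  - by move=> p pd; split=> [Ip|[]].
  - exact: subspace_homog.
  - by apply: (is_qdim_homog (d := d) IP) => p.
exact: piece_subspace.
Qed.

Lemma eq_hilbertP I J d : subspace I -> subspace J ->
  hilbert I d = hilbert J d <-> hdim (piece I d) = hdim (piece J d).
Proof.
move=> /(hdim_homog d) IE /(hdim_homog d) JE; split=> E; apply/eqP.
  by rewrite -(eqn_add2r (hilbert I d)) -IE E -JE.
by rewrite -(eqn_add2l (hdim (piece I d))) -IE E -JE.
Qed.

Lemma ideal_sum I (T : Type) (r : seq T) (P : pred T) (F : T -> R) :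
  is_ideal I -> (forall i, P i -> I (F i)) -> I (\sum_(i <- r | P i) F i).
Proof. by move=> II; apply: (subspace_sum (ideal_subspace II)). Qed.

End HomogeneousComponents.

(** * First and last Betti numbers *)

Section BettiNumbers.
Variables (k : fieldType) (n : nat).
Local Notation R := {mpoly k[n]}.
Implicit Types (I J : R -> Prop) (p q : R).

Lemma tor_boundary_subspace F I i : subspace I -> subspace (@tor_boundary k n F I i).
Proof.
move=> IP.
split=> [|c p q [h hP] [h' h'P]].
  exists 0 => a; rewrite ffunE [fdiff _ _](_ : _ = 0) ?subr0; first exact: IP.1.
  by rewrite ffunE big1 // => b _; rewrite ffunE mul0r.
exists (c *: h + h') => a; have := IP.2 c _ _ (hP a) (h'P a); congr I.
rewrite !ffunE scalerBr addrACA -opprD; congr (_ - _).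
rewrite scaler_sumr -big_split; apply: eq_bigr => b _.
by rewrite !ffunE mulrDl scalerAl.
Qed.

(** The space [R_1 I_d] of the top comment: what degree [d] of [I] contributes to
    degree [d + 1]. *)
Definition linear_multiples I d p :=
  exists u : 'I_n -> R, (forall l, piece I d (u l)) /\ p = \sum_l 'X_l * u l.

Lemma linear_multiples_homog I d : concentrated d.+1 (linear_multiples I d).
Proof.
move=> p [u [uI ->]]; apply: (subspace_sum (subspace_homog k n _)) => l _.
by apply: homog_mulX; case: (uI l).
Qed.

Lemma linear_multiples_subspace I d : subspace I -> subspace (linear_multiples I d).
Proof.
move=> IP; have PP := piece_subspace d IP; split=> [|c _ _ [u [uI ->]] [v [vI ->]]].
  exists (fun _ => 0); split=> [_|]; first exact: PP.1.
  by rewrite big1 // => l _; rewrite mulr0.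
exists (fun l => c *: u l + v l); split=> [l|]; first exact: PP.2.
by rewrite scaler_sumr -big_split; apply: eq_bigr => l _; rewrite mulrDr scalerAr.
Qed.

Lemma linear_multiples_piece I d p : is_ideal I ->
  linear_multiples I d p -> piece I d.+1 p.
Proof.
move=> II Ip; split; first exact: linear_multiples_homog Ip.
case: Ip => u [uI ->]; apply: ideal_sum => // l _.
by case: II => _ _; apply; case: (uI l).
Qed.

Lemma mnm_pick d (m : 'X_{1..n}) : mdeg m = d.+1 ->
  exists (l : 'I_n) u, m = (U_(l) + u)%MM /\ mdeg u = d.
Proof.
move=> md; suff [l ml] : exists l, (0 < m l)%N.
  have lm : (U_(l) <= m)%MM.
    by apply/mnm_lepP => j; rewrite mnm1E; case: eqP => [<-|].
  have mE : m = (U_(l) + (m - U_(l)))%MM by rewrite addmC submK.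
  exists l, (m - U_(l))%MM; split=> //.
  by move: md; rewrite {1}mE mdegD mdeg1 add1n => -[].
apply/existsP; rewrite -[X in is_true X]negbK negb_exists.
apply/negP => /forallP m0; move: md; rewrite mdegE big1 // => l _.
by apply/eqP; rewrite -leqn0 leqNgt m0.
Qed.

Lemma linear_multiples_mulX I l d p : subspace I -> piece I d p ->
  linear_multiples I d ('X_l * p).
Proof.
move=> IP Ip; exists (fun i => if i == l then p else 0); split=> [i|].
  by case: eqP => // _; apply: (piece_subspace d IP).1.
rewrite (bigD1 l) //= eqxx big1 ?addr0 // => i /negPf ->.
by rewrite mulr0.
Qed.

Lemma homog_split d p : p \is d.+1.-homog -> linear_multiples (fun _ => True) d p.
Proof.
move=> pd; rewrite [p]mpolyE big_seq.
have TP : subspace (fun _ : R => True) by split.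
apply: (subspace_sum (linear_multiples_subspace d TP)) => m.
move/(dhomog_mf pd)/mnm_pick => [l [u [-> ud]]].
apply: (subspaceZ (linear_multiples_subspace d TP)); rewrite mpolyXD.
by apply: linear_multiples_mulX => //; split=> //; rewrite dhomogX; apply/eqP.
Qed.

Let idx1 (l : 'I_n) : bas (koszul k n) 1 := Sub [set l] (introT eqP (cards1 l)).
Let idx0 : bas (koszul k n) 0 := Sub set0 (introT eqP (cards0 _)).

Let idx1P (a : bas (koszul k n) 1) : exists l, a = idx1 l.
Proof.
by case/cards1P: (valP a) => l al; exists l; apply: val_inj; rewrite SubK.
Qed.

Let idx0P (b : bas (koszul k n) 0) : b = idx0.
Proof. by apply: val_inj; rewrite SubK; apply/eqP; rewrite -cards_eq0 (valP b). Qed.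

Let fdiff0E (g : free_mod (koszul k n) 1) : fdiff g idx0 = \sum_l 'X_l * g (idx1 l).
Proof.
rewrite ffunE /= /koszul_dif; under eq_bigr do rewrite mulr_sumr.
rewrite (exchange_big_dep xpredT) //=; apply: eq_bigr => l _.
rewrite (big_pred1 (idx1 l)) => [|a].
  rewrite SubK /koszul_sign (_ : #|_| = 0%N) ?expr0 ?mul1r 1?mulrC //.
  by apply/eqP; rewrite cards_eq0; apply/eqP/setP => m; rewrite !inE;
     case: eqP => // ->; rewrite ltnn.
have [l' ->] := idx1P a; rewrite !SubK inE.
apply/andP/eqP => [[/eqP -> _] //|/(congr1 val)].
rewrite !SubK => /setP/(_ l'); rewrite !inE eqxx => /esym/eqP->.
by split=> //; rewrite setDv.
Qed.

(** Sending a cycle [(g_l)_l] to [\sum_l x_l g_l] identifies the classes in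
    [Tor_1] with minimal generators: by exactness of the Koszul complex the
    kernel consists of the boundaries. *)
Lemma betti1P I d : homogeneous_ideal I ->
  is_qdim (piece I d.+1) (linear_multiples I d) (betti I 1 d.+1).
Proof.
move=> [II I_hom]; have IP := ideal_subspace II.
have LP := linear_multiples_subspace d IP.
have [_ _ _ _ exactK] := koszul_resolution k n.
suff E : betti I 1 d.+1 = qdim (piece I d.+1) (linear_multiples I d).
  by rewrite E; apply: (@is_qdim_homog _ _ d.+1) => // p [].
have homogE (g : free_mod (koszul k n) 1) :
    in_degree d.+1 g <-> forall l, g (idx1 l) \is d.-homog.
  split=> [gd l|gd a m]; first by apply/dhomogP => m /gd; rewrite addn1 => -[].
  by have [l ->] := idx1P a; move/dhomogP: (gd l) => gdl /gdl ->; rewrite addn1.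
apply: is_qdim_qdim; first exact: tor_boundary_subspace.
apply: (is_qdim_preimage (phi := fun g : free_mod (koszul k n) 1 => fdiff g idx0)
          (Z' := piece I d.+1) (B' := linear_multiples I d)) => //.
- move=> c g h; rewrite !fdiff0E scaler_sumr -big_split; apply: eq_bigr => l _.
  by rewrite !ffunE mulrDr scalerAr.
- split=> [|c p q [/homogE pd pI] [/homogE qd qI]].
    split; first by apply/homogE => l; rewrite ffunE; apply: dhomog0.
    by move=> b; rewrite ffunE big1 => [|a _]; rewrite ?ffunE ?mul0r; [apply: IP.1|].
  split; first by apply/homogE => l; rewrite !ffunE; apply: (subspace_homog k n d).2.
  move=> b; have := IP.2 c _ _ (pI b) (qI b); congr I.
  rewrite !ffunE scaler_sumr -big_split; apply: eq_bigr => a _.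
  by rewrite !ffunE mulrDl scalerAl.
- move=> g [/homogE gd gI]; split; last exact: gI.
  rewrite fdiff0E; apply: (subspace_sum (subspace_homog k n _)) => l _.
  by apply: homog_mulX.
- move=> g [/homogE gd gI]; split=> [[h hP]|[u [uI gE]]].
    exists (fun l => pihomog mdeg d (g (idx1 l) - fdiff h (idx1 l))); split.
      by move=> l; split; [apply: pihomogP|apply/I_hom/hP].
    have <- : pihomog mdeg d.+1 (fdiff g idx0) = fdiff g idx0.
      apply: pihomog_dE; rewrite fdiff0E; apply: (subspace_sum (subspace_homog k n _)) => l _.
      by apply: homog_mulX.
    under eq_bigr => l do rewrite -pihomog_mulX mdeg1 add1n.
    rewrite -raddf_sum; congr pihomog.
    under eq_bigr do rewrite mulrBr.
    rewrite sumrB -!fdiff0E.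
    have -> : fdiff (fdiff h) = 0 by apply/exactK; exists h.
    by rewrite [X in _ - X]ffunE subr0.
  pose w (a : bas (koszul k n) 1) : R := \sum_(l in val a) u l.
  pose v : free_mod (koszul k n) 1 := [ffun a => w a].
  have vE l : v (idx1 l) = u l by rewrite ffunE /w SubK big_set1.
  have /exactK[h hE] : fdiff (g - v) = 0.
    apply/ffunP => b; rewrite (idx0P b) fdiff0E [RHS]ffunE.
    under eq_bigr => l do rewrite ffunE [X in _ + X]ffunE mulrBr.
    rewrite sumrB -fdiff0E gE; apply/eqP; rewrite subr_eq0; apply/eqP.
    by apply: eq_bigr => l _; rewrite vE.
  exists h => a; have [l ->] := idx1P a.
  have -> : fdiff h (idx1 l) = g (idx1 l) - u l.
    by rewrite -hE ffunE [X in _ + X]ffunE vE.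
  by rewrite opprB addrC subrK; case: (uI l).
- move=> p [pd pI].
  have [u [ud pE]] := homog_split pd; rewrite pE.
  pose w (a : bas (koszul k n) 1) : R := \sum_(l in val a) u l.
  pose v : free_mod (koszul k n) 1 := [ffun a => w a].
  have vE l : v (idx1 l) = u l by rewrite ffunE /w SubK big_set1.
  have v0 : fdiff v idx0 = \sum_l 'X_l * u l.
    by rewrite fdiff0E; apply: eq_bigr => l _; rewrite vE.
  exists v; rewrite v0 subrr; split; last exact: LP.1.
  split; first by apply/homogE => l; rewrite vE; case: (ud l).
  by move=> b; rewrite (idx0P b) v0 -pE.
- by apply: (@is_qdim_homog _ _ d.+1) => // p [].
Qed.

Lemma betti10 I : is_ideal I -> betti I 1 0 = 0%N.
Proof.
move=> II; have BP := tor_boundary_subspace (koszul k n) 1 (ideal_subspace II).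
apply: is_qdim_qdim => //; exists (fun _ => 0); split=> [[]|c _ []|g [gd _]] //.
exists (fun _ => 0); rewrite big_ord0 subr0.
suff -> : g = 0 by apply: BP.1.
apply/ffunP => a; rewrite ffunE; apply: msuppnil0.
case E: (msupp _) => [|m s] //; have := gd a m.
by rewrite E mem_head addn1 => /(_ isT).
Qed.


Definition socle J p := forall l : 'I_n, J ('X_l * p).

Lemma socle_piece_subspace J d : is_ideal J -> subspace (piece (socle J) d).
Proof.
move=> JJ; apply: piece_subspace; have JP := ideal_subspace JJ.
split=> [l|c p q Jp Jq l]; first by rewrite mulr0; apply: JP.1.
by rewrite mulrDr -scalerAr; apply: JP.2.
Qed.

End BettiNumbers.

(** The last module of the Koszul complex is free on one generator, of degree
    [n], and receives no boundaries; the components of the differential are the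
    variables up to sign. *)
Lemma betti_topP (k : fieldType) n (J : {mpoly k[n]} -> Prop) d :
  (0 < n)%N -> is_ideal J ->
  is_qdim (piece (socle J) d) J (betti J n (d + n)).
Proof.
case: n J => // n J _ JJ; have JP := ideal_subspace JJ.
suff -> : betti J n.+1 (d + n.+1) = qdim (piece (socle J) d) J.
  by apply: (@is_qdim_homog _ _ d) => // p [].
have cT : #|[set: 'I_n.+1]| == n.+1 by rewrite cardsT card_ord.
pose top : bas (koszul k n.+1) n.+1 := Sub setT cT.
have topP (a : bas (koszul k n.+1) n.+1) : a = top.
  apply: val_inj; rewrite SubK; apply/eqP; rewrite eqEcard subsetT /=.
  by rewrite (eqP cT) (eqP (valP a)).
have fdiff0 (h : free_mod (koszul k n.+1) n.+2) : fdiff h = 0.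
  apply/ffunP => b; rewrite !ffunE big1 // => a _; exfalso.
  have := subset_leq_card (subsetT (val a)).
  by rewrite (eqP cT) (eqP (valP a)) ltnn.
have cycleP (g : free_mod (koszul k n.+1) n.+1) :
    tor_cycle J g <-> socle J (g top).
  case: (JJ) => J0 JD JM; split=> [Jg l|Jg b].
    have cl : #|[set: 'I_n.+1] :\ l| == n.
      by have := cardsD1 l [set: 'I_n.+1]; rewrite (eqP cT) in_setT add1n => -[<-].
    have := Jg (Sub ([set: 'I_n.+1] :\ l) cl); rewrite ffunE (big_pred1 top) => [|a]; last first.
      by apply/esym/eqP/topP.
    rewrite /= /koszul_dif (big_pred1 l) => [|l']; last first.
      rewrite !inE; apply/eqP/eqP => [/setP/(_ l')|->] //.
      by rewrite !inE eqxx andbT => /negbFE/eqP.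
    rewrite /koszul_sign -signr_odd; case: odd.
      by rewrite expr1 mulN1r mulrN mulrC => /(subspaceN JP); rewrite opprK.
    by rewrite expr0 mul1r mulrC.
  rewrite ffunE; apply: ideal_sum => // a _.
  rewrite (topP a) /= /koszul_dif mulr_sumr; apply: ideal_sum => // l _.
  by rewrite mulrCA; apply: JM; rewrite mulrC.
apply: is_qdim_qdim; first exact: tor_boundary_subspace.
apply: (is_qdim_preimage (phi := fun g : free_mod (koszul k n.+1) n.+1 => g top)
          (Z' := piece (socle J) d) (B' := J)) => //.
- by move=> c g h; rewrite !ffunE.
- split=> [|c p q [pd /cycleP pJ] [qd /cycleP qJ]]; split.
  + by move=> b m; rewrite ffunE msupp0.
  + by apply/cycleP => l; rewrite ffunE mulr0; apply: JP.1.
  + move=> b m; rewrite !ffunE => /msuppD_le; rewrite mem_cat => /orP[|/qd //].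
    by move/msuppZ_le/pd.
  + by apply/cycleP => l; rewrite !ffunE mulrDr -scalerAr; apply: JP.2.
- move=> g [gd /cycleP gJ]; split=> //; apply/dhomogP => m /gd.
  exact: addIn.
- move=> g _; split=> [[h /(_ top)]|gJ]; first by rewrite fdiff0 ffunE subr0.
  by exists 0 => a; rewrite (topP a) fdiff0 ffunE subr0.
- move=> p [pd pJ]; pose g : free_mod (koszul k n.+1) n.+1 := [ffun _ => p].
  exists g; rewrite ffunE subrr; split; last exact: JP.1.
  split; last by apply/cycleP => l; rewrite ffunE.
  by move=> b m; rewrite ffunE => /(dhomog_mf pd) ->.
- by apply: (@is_qdim_homog _ _ d) => // p [].
Qed.

(** * Generated ideals and monomial ideals *)

Section GeneratedIdeals.
Variables (k : fieldType) (n : nat).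
Local Notation R := {mpoly k[n]}.
Implicit Types (I : R -> Prop) (s : seq R) (p : R) (m u v : 'X_{1..n}).

Lemma ideal_gen_ideal s : is_ideal (ideal_gen s).
Proof.
split=> [|p q [c ->] [b ->]|r p [c ->]].
- by exists (fun _ => 0); rewrite big1 // => i _; rewrite mul0r.
- exists (fun i => c i + b i); rewrite -big_split; apply: eq_bigr => i _.
  by rewrite mulrDl.
- exists (fun i => r * c i); rewrite mulr_sumr; apply: eq_bigr => i _.
  by rewrite mulrA.
Qed.

Lemma ideal_gen_mem s p : p \in s -> ideal_gen s p.
Proof.
move=> ps; have ip : (index p s < size s)%N by rewrite index_mem.
exists (fun i => if i == Ordinal ip then 1 else 0).
rewrite (bigD1 (Ordinal ip)) //= eqxx mul1r nth_index // big1 ?addr0 // => i /negPf ->.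
by rewrite mul0r.
Qed.

Lemma ideal_gen_sub s I p : is_ideal I -> (forall g, g \in s -> I g) ->
  ideal_gen s p -> I p.
Proof.
move=> II sI [c ->]; apply: ideal_sum => // i _; case: II => _ _; apply.
by apply/sI/mem_nth.
Qed.

Definition upclosed (S : 'X_{1..n} -> Prop) := forall u v, S v -> S (u + v)%MM.

Definition monomial_span (S : 'X_{1..n} -> Prop) p := forall m, m \in msupp p -> S m.

Lemma monomial_span_subspace S : subspace (monomial_span S).
Proof.
split=> [m|c p q pS qS m /msuppD_le]; first by rewrite msupp0.
by rewrite mem_cat => /orP[/msuppZ_le/pS|/qS].
Qed.

Lemma monomial_spanX S m : monomial_span S 'X_[m] <-> S m.
Proof.
by split=> [|Sm u]; [apply; rewrite msuppX mem_head|rewrite msuppX inE => /eqP ->].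
Qed.

Lemma monomial_span_ideal S : upclosed S -> is_ideal (monomial_span S).
Proof.
move=> Sup; have SP := monomial_span_subspace S; split=> [|p q|r p pS m].
- exact: SP.1.
- exact: subspaceD.
by move/msuppM_le/allpairsP => -[[u v] /= [_ /pS Sv ->]]; apply: Sup.
Qed.

Lemma monomial_span_homogeneous S : upclosed S -> homogeneous_ideal (monomial_span S).
Proof.
move=> Sup; split=> [|p d pS m]; first exact: monomial_span_ideal.
rewrite mcoeff_msupp mcoeff_pihomog; case: ifP => _; last by rewrite eqxx.
by rewrite -mcoeff_msupp; apply: pS.
Qed.

Lemma subspace_monomial_span I S p :
  subspace I -> (forall m, S m -> I 'X_[m]) -> monomial_span S p -> I p.
Proof.
move=> IP SI pS; rewrite [p]mpolyE big_seq; apply: (subspace_sum IP) => m mp.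
by apply: (subspaceZ IP); apply/SI/pS.
Qed.

Definition multiples (G : seq 'X_{1..n}) m := exists2 g, g \in G & (g <= m)%MM.

Lemma multiples_upclosed G : upclosed (multiples G).
Proof. by move=> u v [g Gg gv]; exists g => //; apply: lepm_trans gv (lem_addl _ _). Qed.

Lemma ideal_gen_monomials G p :
  ideal_gen [seq 'X_[m] | m <- G] p <-> monomial_span (multiples G) p.
Proof.
split.
  apply: ideal_gen_sub => [|_ /mapP[m mG ->]].
    exact/monomial_span_ideal/multiples_upclosed.
  by apply/monomial_spanX; exists m => //; apply: lepm_refl.
apply: subspace_monomial_span => [|m [g gG /submK <-]].
  exact/ideal_subspace/ideal_gen_ideal.
rewrite mpolyXD; case: (ideal_gen_ideal [seq 'X_[m] | m <- G]) => _ _; apply.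
by apply: ideal_gen_mem; apply: map_f.
Qed.

Lemma eq_lepm_mdeg u v : (u <= v)%MM -> mdeg u = mdeg v -> u = v.
Proof.
move=> /submK <-; rewrite mdegD => /eqP; rewrite -[X in X == _]add0n eqn_add2r eq_sym.
by rewrite mdeg_eq0 => /eqP ->; rewrite add0m.
Qed.

Lemma lepm_proper u v : (u <= v)%MM -> u != v ->
  exists (l : 'I_n) w, v = (U_(l) + w)%MM /\ (u <= w)%MM.
Proof.
move=> uv ne; case E : (mdeg (v - u)%MM) => [|d].
  move: E ne => /eqP; rewrite mdeg_eq0 => /eqP E.
  by rewrite -(submK uv) E add0m eqxx.
have [l [w [vuE _]]] := mnm_pick E.
exists l, (w + u)%MM; rewrite lem_addl addmA -vuE submK //.
Qed.

End GeneratedIdeals.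

(** * Lexicographic order *)

Section LexOrder.
Variable n : nat.
Implicit Types (m u v w : 'X_{1..n}) (i j l p q : 'I_n).

Lemma lex_ltP m m' : mdeg m = mdeg m' -> lex_lt m m' <-> (m < m')%O.
Proof.
move=> mm'; split=> [[i [mi lti]]|/(ltmcP mm')[i mi lti]]; last by exists i.
by apply/(ltmcP mm'); exists i.
Qed.

Lemma mnmU_le i u q : (u q <= (U_(i) + u)%MM q)%N.
Proof. by rewrite mnmDE leq_addl. Qed.

Lemma mnmU_neq i u q : q != i -> (U_(i) + u)%MM q = u q.
Proof. by move=> qi; rewrite mnmDE mnm1E eq_sym (negPf qi). Qed.

Lemma mnmU_eq i u : (U_(i) + u)%MM i = (u i).+1.
Proof. by rewrite mnmDE mnm1E eqxx. Qed.

Lemma ltn_neq_ord p q : (p < q)%N -> p != q.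
Proof. by move=> pq; apply: contraTneq pq => ->; rewrite ltnn. Qed.

(** The largest divisor of [v] of colength one is obtained by dividing by the
    last variable occurring in [v]. *)
Lemma lex_lt_divisor i u v : mdeg v = (mdeg u).+1 -> lex_lt (U_(i) + u) v ->
  exists j w, v = (U_(j) + w)%MM /\ (w = u \/ lex_lt u w).
Proof.
move=> vu [p [eq_p lt_p]].
have vp : (0 < v p)%N by apply: leq_ltn_trans lt_p.
have [j vj j_max] := @arg_maxnP _ p (fun q => 0 < v q)%N (@nat_of_ord n) vp.
have pj : (p <= j)%N := j_max _ vp.
have [w vE] : exists w, v = (U_(j) + w)%MM.
  exists (v - U_(j))%MM; rewrite addmC submK //; apply/mnm_lepP => q.
  by rewrite mnm1E; case: eqP => [<-|].
exists j, w; split=> //.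
have wE q : q != j -> w q = v q by move=> qj; rewrite vE mnmU_neq.
have wj : (w j).+1 = v j by rewrite vE mnmU_eq.
have w_lt q : (q < p)%N -> w q = (U_(i) + u)%MM q.
  by move=> qp; rewrite wE -?eq_p //; apply: ltn_neq_ord (leq_trans qp pj).
have [ip|pi] := ltnP i p.
  right; exists i; split=> [q qi|]; last by rewrite w_lt // mnmU_eq.
  by rewrite w_lt ?(ltn_trans qi) // mnmU_neq // ltn_neq_ord.
have u_lt q : (q < p)%N -> u q = w q.
  by move=> qp; rewrite w_lt // mnmU_neq // ltn_neq_ord // (leq_trans qp).
have [up|] := ltnP (u p) (w p); first by right; exists p.
move=> wp; have jp : j = p.
  apply/eqP; apply: contraTT wp => jp; rewrite -ltnNge.
  rewrite (wE p); last by rewrite eq_sym.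
  by apply: leq_ltn_trans lt_p; apply: mnmU_le.
have wu : mdeg w = mdeg u.
  by apply: succn_inj; rewrite -vu vE mdegD mdeg1 add1n.
left; apply: eq_lepm_mdeg => //.
apply/mnm_lepP => q; case: (ltngtP q p) => [/u_lt -> //|pq|/val_inj -> //].
rewrite wE; last by rewrite jp eq_sym ltn_neq_ord.
have [->//|] := posnP (v q); move/j_max.
by rewrite /= jp leqNgt pq.
Qed.

Variable a : 'I_n -> nat.

Definition pure_multiple m : bool := [exists i, (a i <= m i)%N].

Lemma pure_multiple_upclosed : upclosed (fun m => pure_multiple m).
Proof.
move=> u v /existsP[i ai]; apply/existsP; exists i.
by rewrite mnmDE (leq_trans ai) // leq_addl.
Qed.

(** The mirror image of [lex_lt_divisor] under the involution of the monomials
    below the powers which replaces the exponents by their complements. *)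
Lemma lex_lt_multiple i u v : mdeg v = mdeg u -> lex_lt v u ->
    ~~ pure_multiple v -> ~~ pure_multiple (U_(i) + u)%MM ->
  exists j, ~~ pure_multiple (U_(j) + v)%MM /\
    ((U_(j) + v)%MM = (U_(i) + u)%MM \/ lex_lt (U_(j) + v) (U_(i) + u)).
Proof.
move=> vu [p [eq_p lt_p]] /existsPn v_box /existsPn u_box.
have {}v_box q : (v q < a q)%N by rewrite ltnNge v_box.
have {}u_box q : ((U_(i) + u)%MM q < a q)%N by rewrite ltnNge u_box.
have vp : ((v p).+1 < a p)%N.
  by apply: leq_ltn_trans (u_box p); apply: leq_trans lt_p (mnmU_le _ _ _).
have [j vj j_max] := @arg_maxnP _ p (fun q => (v q).+1 < a q)%N (@nat_of_ord n) vp.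
have pj : (p <= j)%N := j_max _ vp.
exists j; split.
  apply/existsPn => q; rewrite -ltnNge.
  by have [->|qj] := eqVneq q j; rewrite ?mnmU_eq ?mnmU_neq.
have v_lt q : (q < p)%N -> (U_(j) + v)%MM q = u q.
  by move=> qp; rewrite mnmU_neq ?eq_p // ltn_neq_ord // (leq_trans qp).
have [ip|pi] := ltnP i p.
  right; exists i; split=> [q qi|]; last by rewrite v_lt // mnmU_eq.
  by rewrite v_lt ?(ltn_trans qi) // mnmU_neq // ltn_neq_ord.
have u_lt q : (q < p)%N -> (U_(j) + v)%MM q = (U_(i) + u)%MM q.
  by move=> qp; rewrite v_lt // mnmU_neq // ltn_neq_ord // (leq_trans qp).
have [up|] := ltnP ((U_(j) + v)%MM p) ((U_(i) + u)%MM p); first by right; exists p.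
move=> wp; have jp : j = p.
  apply/eqP; apply: contraTT wp => jp; rewrite -ltnNge.
  rewrite (@mnmU_neq j v p); last by rewrite eq_sym.
  by apply: leq_trans lt_p _; apply: mnmU_le.
left; apply/esym/eq_lepm_mdeg; last by rewrite !mdegD !mdeg1 vu.
apply/mnm_lepP => q; case: (ltngtP q p) => [/u_lt -> //|pq|/val_inj -> //].
rewrite (@mnmU_neq j v q); last by rewrite jp eq_sym ltn_neq_ord.
rewrite -ltnS; apply: leq_trans (u_box q) _.
by rewrite leqNgt; apply/negP => /j_max; rewrite /= jp leqNgt pq.
Qed.

End LexOrder.

(** * Lex plus powers ideals as sets of monomials *)

Section LexPlusPowers.
Variables (k : fieldType) (n : nat) (a : 'I_n -> nat).
Local Notation R := {mpoly k[n]}.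
Implicit Types (L : R -> Prop) (S : 'X_{1..n} -> Prop) (m u v : 'X_{1..n}).

Definition pure i : 'X_{1..n} := (U_(i) *+ a i)%MM.

Lemma pureE i j : pure i j = if i == j then a i else 0%N.
Proof. by rewrite mulmnE mnm1E; case: eqP; rewrite ?mul1n ?mul0n. Qed.

Lemma pure_lepm i m : (pure i <= m)%MM = (a i <= m i)%N.
Proof.
apply/mnm_lepP/idP => [/(_ i)|am j]; first by rewrite pureE eqxx.
by rewrite pureE; case: eqP => [<-|].
Qed.

Lemma pure_multiple_pure i : pure_multiple a (pure i).
Proof. by apply/existsP; exists i; rewrite pureE eqxx. Qed.

Lemma mdeg_pure i : mdeg (pure i) = a i.
Proof. by rewrite mdegMn mdeg1 mul1n. Qed.

Lemma mpolyX_pure i : 'X_[pure i] = 'X_i ^+ a i :> R.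
Proof. by rewrite mpolyXn. Qed.

(** The set of monomials of a lex plus powers ideal, freed from the choice of
    generators: below the powers it is a lex segment in every degree, although
    the definition of the ideal asks for this only in the degrees of its
    generators. *)
Record lpp_monomials S : Prop := LppMonomials {
  lpp_upclosed : upclosed S;
  lpp_pure : forall m, pure_multiple a m -> S m;
  lpp_pure_min : forall i c, S (U_(i) *+ c)%MM -> (a i <= c)%N;
  lpp_lex : forall m m', S m -> ~~ pure_multiple a m ->
              mdeg m' = mdeg m -> lex_lt m m' -> S m' }.

Lemma lepm_mulmn i c m : (m <= U_(i) *+ c)%MM -> m = (U_(i) *+ m i)%MM /\ (m i <= c)%N.
Proof.
move=> mc; have m_le j : (m j <= (i == j) * c)%N.
  by have := mnm_lepP mc j; rewrite mulmnE mnm1E.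
split; last by have := m_le i; rewrite eqxx mul1n.
apply/mnmP => j; rewrite mulmnE mnm1E; case: eqP (m_le j) => [<-|_]; first by rewrite !mul1n.
by rewrite !mul0n leqn0 => /eqP.
Qed.

(** The lex condition passes from the degree of a generator to all higher
    degrees one variable at a time, by [lex_lt_divisor]. *)
Lemma lex_plus_powers_monomials L : lex_plus_powers a L ->
  exists2 S, lpp_monomials S & forall p, L p <-> monomial_span S p.
Proof.
case=> ms [[LG G_min] L_lex].
pose P := [seq pure i | i <- enum 'I_n]; pose G := P ++ ms.
have GE : [seq 'X_i ^+ a i | i <- enum 'I_n] ++ [seq 'X_[m] | m <- ms] =
          [seq 'X_[m] | m <- G] :> seq R.
  rewrite map_cat; congr (_ ++ _); rewrite /P.
  by elim: (enum 'I_n) => //= i s ->; rewrite mpolyX_pure.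
have LE p : L p <-> monomial_span (multiples G) p.
  by rewrite LG GE; apply: ideal_gen_monomials.
have Gup := @multiples_upclosed _ G.
have pureG i : pure i \in G by rewrite mem_cat map_f ?mem_enum.
exists (multiples G) => //; split=> //.
- by move=> m /existsP[i im]; exists (pure i); rewrite ?pure_lepm.
- move=> i c [g gG /lepm_mulmn[gE gc]]; rewrite leqNgt; apply/negP => ca.
  have g_neq : g != pure i.
    by apply: contraTneq gc => ->; rewrite pureE eqxx -ltnNge.
  have [s1 [s2 GE']] : exists s1 s2, G = s1 ++ pure i :: s2.
    by case/splitPr: (pureG i) => s1 s2; exists s1, s2.
  apply: (G_min [seq 'X_[m] | m <- s1] 'X_[pure i] [seq 'X_[m] | m <- s2]).
    by rewrite GE GE' map_cat.
  rewrite -map_cat; apply/ideal_gen_monomials/monomial_spanX; exists g.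
    by move: gG; rewrite GE' !mem_cat inE (negPf g_neq).
  rewrite gE; apply/mnm_lepP => j; rewrite mulmnE mnm1E pureE.
  by case: eqP => //= _; rewrite mul1n ltnW // (leq_ltn_trans gc).
move=> m m' [g gG gm] mbox; rewrite mem_cat in gG.
have {gG} gms : g \in ms.
  case/orP: gG => // /mapP[i _ gE]; case/negP: mbox.
  by apply/existsP; exists i; rewrite -pure_lepm -gE.
rewrite -(submK gm) in mbox *; move: (m - g)%MM {gm mbox} => w.
move: {2}(mdeg w) (erefl (mdeg w)) => d.
elim: d w m' => [|d IHd] w m' wd m'd.
  have /eqP := wd; rewrite mdeg_eq0 => /eqP w0; rewrite w0 add0m in m'd * => gm'.
  by apply/monomial_spanX/LE/(L_lex g).
have [l [w' [wE w'd]]] := mnm_pick wd; rewrite wE -addmA => lt_m'.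
have [|j [v [vE v_ge]]] := lex_lt_divisor _ lt_m'.
  by rewrite m'd wE !mdegD mdeg1.
rewrite vE in m'd *; apply: Gup; case: v_ge => [->|lt_v].
  by exists g; [rewrite mem_cat gms orbT|apply: lem_addl].
apply: (IHd w') => //.
by move: m'd; rewrite wE -addmA !mdegD mdeg1 (mdeg1 l) => /addnI.
Qed.

(** The generators are the minimal elements of the set, and there are finitely
    many of them: apart from the powers they lie below the powers. *)
Lemma lpp_monomials_lex_plus_powers S : (forall i, (0 < a i)%N) ->
  lpp_monomials S -> lex_plus_powers a (@monomial_span k n S).
Proof.
move=> a_gt0 [Sup Spure Spure_min Slex].
pose minimal m := S m /\ forall (l : 'I_n) u, m = (U_(l) + u)%MM -> ~ S u.
pose good m := ~~ pure_multiple a m /\ minimal m.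
pose T : finType := 'X_{1..n < (\sum_i a i).+1}.
pose ms := [seq bmnm x | x <- enum T
             & if excluded_middle_informative (good (bmnm x)) then true else false].
have msP m : m \in ms <-> good m.
  split=> [/mapP[x]|mg]; first by rewrite mem_filter => /andP[+ _ ->]; case: excluded_middle_informative.
  have mT : (mdeg m < (\sum_i a i).+1)%N.
    rewrite ltnS mdegE; apply: leq_sum => i _.
    by case: mg => /existsPn/(_ i); rewrite -ltnNge => /ltnW.
  apply/mapP; exists (BMultinom mT) => //; rewrite mem_filter mem_enum.
  by case: excluded_middle_informative.
pose P := [seq pure i | i <- enum 'I_n]; pose G := P ++ ms.
have GE : [seq 'X_i ^+ a i | i <- enum 'I_n] ++ [seq 'X_[m] | m <- ms] =
          [seq 'X_[m] | m <- G] :> seq R.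
  rewrite map_cat; congr (_ ++ _); rewrite /P.
  by elim: (enum 'I_n) => //= i s ->; rewrite mpolyX_pure.
have GS m : m \in G -> S m.
  rewrite mem_cat => /orP[/mapP[i _ ->]|/msP[_ []] //].
  exact/Spure/pure_multiple_pure.
have SG m : S m <-> multiples G m.
  split=> [|[g /GS Sg /submK <-]]; last exact: Sup.
  move: {2}(mdeg m) (leqnn (mdeg m)) => d; elim: d m => [|d IHd] m md Sm.
    have {}md : m = 0%MM by apply/eqP; rewrite -mdeg_eq0 -leqn0.
    have [/existsP[i ai]|mbox] := boolP (pure_multiple a m).
      by move: ai; rewrite md mnm0E leqNgt a_gt0.
    exists m; last exact: lepm_refl.
    rewrite mem_cat; apply/orP; right; apply/msP; split=> //; split=> // l u mE.
    by move: (congr1 mdeg md); rewrite mE mdegD mdeg1 mdeg0.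
  have [/existsP[i ai]|mbox] := boolP (pure_multiple a m).
    by exists (pure i); rewrite ?pure_lepm // mem_cat map_f ?mem_enum.
  have [mm|/not_and_or[//|]] := classic (minimal m).
    by exists m; [rewrite mem_cat orbC; apply/orP; left; apply/msP|apply: lepm_refl].
  case/not_all_ex_not => l /not_all_ex_not[u nu].
  have [mE /NNPP Su] := imply_to_and _ _ nu.
  have [|g gG gu] := IHd u _ Su; first by move: md; rewrite mE mdegD mdeg1.
  by exists g => //; rewrite mE; apply: lepm_trans gu (lem_addl _ _).
have G_uniq : uniq G.
  have pure_inj : injective pure.
    move=> i j /mnmP/(_ i); rewrite !pureE eqxx; case: eqP => [-> //|_ ai].
    by have := a_gt0 i; rewrite ai.
  rewrite cat_uniq (map_inj_uniq pure_inj) enum_uniq (map_inj_uniq val_inj).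
  rewrite filter_uniq ?enum_uniq // andbT /=.
  apply/hasPn => m /msP[mbox _]; apply: contra mbox => /mapP[i _ ->].
  exact: pure_multiple_pure.
have G_min g g' : g \in G -> S g' -> (g' <= g)%MM -> g' = g.
  rewrite mem_cat => /orP[/mapP[i _ ->] Sg' /lepm_mulmn[g'E g'i]|/msP[_ [_ g_min]] Sg' gg'].
    rewrite g'E in Sg'; have ai := Spure_min _ _ Sg'.
    by rewrite g'E /pure; congr (_ *+ _)%MM; apply/eqP; rewrite eqn_leq g'i.
  apply/eqP/negPn/negP => ne; have [l [w [gE g'w]]] := lepm_proper gg' ne.
  by apply: (g_min l w gE); rewrite -(submK g'w); apply: Sup.
exists ms; rewrite GE; split; first split.
- move=> p; rewrite ideal_gen_monomials.
  by split=> pS m /pS/SG.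
- move=> s1 g s2 Gs; have [t1 [m [t2 [Gt -> <- <-]]]] :
      exists t1 m t2, [/\ G = t1 ++ m :: t2, g = 'X_[m],
        [seq 'X_[m] | m <- t1] = s1 & [seq 'X_[m] | m <- t2] = s2].
    elim: s1 (G) Gs => [|x s1 IHs] [|m G'] //= [].
      by move=> <- <-; exists [::], m, G'.
    by move=> <- /IHs[t1 [m' [t2 [-> -> <- <-]]]]; exists (m :: t1), m', t2.
  rewrite -map_cat => /ideal_gen_monomials/monomial_spanX[g' g't g'm].
  have g'G : g' \in G by move: g't; rewrite Gt !mem_cat inE => /orP[->|->]; rewrite ?orbT.
  have mG : m \in G by rewrite Gt mem_cat mem_head orbT.
  have E := G_min _ _ mG (GS _ g'G) g'm; move: g't G_uniq.
  rewrite E Gt mem_cat uniq_catC /= mem_cat => mt /andP[/negP[]].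
  by rewrite orbC.
- move=> m m' /msP[mbox [Sm _]] m'm lt_mm'; apply/monomial_spanX.
  exact: (Slex m).
Qed.

End LexPlusPowers.

(** * Regular sequences *)

Section RegularSequences.
Variables (k : fieldType) (n : nat).
Local Notation R := {mpoly k[n]}.
Implicit Types (f g : 'I_n -> R) (a : 'I_n -> nat) (p : R).

Definition partial_ideal f i p :=
  exists c : 'I_n -> R, p = \sum_(j : 'I_n | (j < i)%N) c j * f j.

Lemma partial_ideal_ideal f i : is_ideal (partial_ideal f i).
Proof.
split=> [|p q [c ->] [b ->]|r p [c ->]].
- by exists (fun _ => 0); rewrite big1 // => j _; rewrite mul0r.
- exists (fun j => c j + b j); rewrite -big_split; apply: eq_bigr => j _.
  by rewrite mulrDl.
- exists (fun j => r * c j); rewrite mulr_sumr; apply: eq_bigr => j _.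
  by rewrite mulrA.
Qed.

Lemma partial_ideal_mem f i (j : 'I_n) : (j < i)%N -> partial_ideal f i (f j).
Proof.
move=> ji; exists (fun l => (l == j)%:R).
rewrite (bigD1 j) //= eqxx mul1r big1 ?addr0 // => l /andP[_ /negPf ->].
by rewrite mul0r.
Qed.

Lemma partial_ideal_sub f i I p : is_ideal I ->
  (forall j : 'I_n, (j < i)%N -> I (f j)) -> partial_ideal f i p -> I p.
Proof.
move=> II If [c ->]; apply: ideal_sum => // j ji; case: II => _ _; apply.
exact: If.
Qed.

Lemma ideal_gen_initial f i p :
  ideal_gen [seq f j | j : 'I_n <- enum 'I_n & (j < i)%N] p <-> partial_ideal f i p.
Proof.
split.
  apply: ideal_gen_sub => [|_ /mapP[j + ->]]; first exact: partial_ideal_ideal.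
  by rewrite mem_filter => /andP[ji _]; apply: partial_ideal_mem.
apply: partial_ideal_sub => [|j ji]; first exact: ideal_gen_ideal.
by apply/ideal_gen_mem/map_f; rewrite mem_filter ji mem_enum.
Qed.

Definition nonzerodivisors f :=
  forall (i : 'I_n) p, partial_ideal f i (p * f i) -> partial_ideal f i p.

Lemma regular_nonzerodivisors f : regular_sequence f -> nonzerodivisors f.
Proof.
by move=> [f_reg _] i g /ideal_gen_initial/f_reg/ideal_gen_initial.
Qed.

Lemma pihomog_mul_homog d e (c g : R) : g \is e.-homog ->
  pihomog mdeg d (c * g) = if (e <= d)%N then pihomog mdeg (d - e) c * g else 0.
Proof.
move=> ge; rewrite [c]mpolyE mulr_suml !raddf_sum /=.
have E u : pihomog mdeg d (c@_u *: 'X_[u] * g) =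
    if (e <= d)%N then pihomog mdeg (d - e) (c@_u *: 'X_[u]) * g else 0.
  have ug : c@_u *: 'X_[u] * g \is (mdeg u + e).-homog.
    by apply: dhomogM => //; apply: dhomogZ; rewrite dhomogX.
  have uu : c@_u *: 'X_[u] \is (mdeg u).-homog by apply: dhomogZ; rewrite dhomogX.
  have [eud|ne] := eqVneq (mdeg u + e)%N d.
    by rewrite -eud leq_addl addnK !pihomog_dE.
  rewrite (pihomog_ne0 ne) //; case: leqP => // ed.
  rewrite (pihomog_ne0 _ uu) ?mul0r //.
  by apply: contraNneq ne => ->; rewrite subnK.
under eq_bigr do rewrite E.
by case: ifP; rewrite ?mulr_suml // big1.
Qed.

Section HomogeneousSequence.
Variables (a : 'I_n -> nat) (f : 'I_n -> R).
Hypothesis f_homog : forall i, f i \is (a i).-homog.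

Lemma pihomog_lincomb d i (c : 'I_n -> R) :
  pihomog mdeg d (\sum_(j : 'I_n | (j < i)%N) c j * f j) =
  \sum_(j : 'I_n | (j < i)%N)
    (if (a j <= d)%N then pihomog mdeg (d - a j) (c j) else 0) * f j.
Proof.
rewrite raddf_sum /=; apply: eq_bigr => j _; rewrite (pihomog_mul_homog _ _ (f_homog j)).
by case: ifP; rewrite ?mul0r.
Qed.

(** Multiplication by [f i] identifies [R / (f_0, ..., f_(i-1))], shifted by
    [a i], with the step from [(f_0, ..., f_(i-1))] to [(f_0, ..., f_i)]. *)
Lemma hdim_partial_idealS (i : 'I_n) d : nonzerodivisors f ->
  hdim (piece (partial_ideal f i.+1) d) =
  (hdim (piece (partial_ideal f i) d) +
   (if (a i <= d)%N then hilbert (partial_ideal f i) (d - a i) else 0))%N.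
Proof.
move=> f_nzd; have FP j := ideal_subspace (partial_ideal_ideal f j).
have lti j : (j < i.+1)%N && (j != i) = (j < i)%N.
  by rewrite ltnS ltn_neqAle andbC.
have sub p : partial_ideal f i p -> partial_ideal f i.+1 p.
  apply: partial_ideal_sub => [|j ji]; first exact: partial_ideal_ideal.
  exact/partial_ideal_mem/ltnW.
have splitS p : piece (partial_ideal f i.+1) d p ->
    exists q, piece (partial_ideal f i) d q /\
      exists c, p = q + (if (a i <= d)%N then pihomog mdeg (d - a i) c else 0) * f i.
  case=> pd [c pE]; exists (\sum_(j : 'I_n | (j < i)%N)
    (if (a j <= d)%N then pihomog mdeg (d - a j) (c j) else 0) * f j).
  split; first split; [by rewrite -pihomog_lincomb; apply: pihomogP|by eexists|].
  exists (c i); rewrite -[LHS](pihomog_dE pd) pE pihomog_lincomb.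
  by rewrite (bigD1 i) //= addrC; congr (_ + _); apply: eq_bigl => j; rewrite lti.
case: leqP => ad; last first.
  rewrite addn0; apply: (@eq_hdim _ _ d) => [p [] //|p]; split=> [|[pd /sub pf]] //.
  by move=> /splitS[q [qF [c]]]; rewrite leqNgt ad mul0r addr0 => ->.
rewrite (@hdim_add _ _ d _ (piece (partial_ideal f i) d)); last 3 first.
- by move=> p [].
- exact: piece_subspace.
- by move=> p [pd /sub].
congr (_ + _)%N; apply: is_qdim_qdim; first exact: piece_subspace.
apply: (is_qdim_image (phi := fun p => p * f i) (Z := fun p => p \is (d - a i).-homog)
          (B := partial_ideal f i)).
- by move=> c p q; rewrite mulrDl scalerAl.
- exact: subspace_homog.
- exact: piece_subspace.
- move=> p pd; split; first by rewrite -(subnK ad); apply: dhomogM.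
  by case: (partial_ideal_ideal f i.+1) => _ _; apply; apply: partial_ideal_mem.
- move=> p pd; split=> [pF|[_ /f_nzd] //].
  split; first by rewrite -(subnK ad); apply: dhomogM.
  by rewrite mulrC; case: (partial_ideal_ideal f i) => _ _; apply.
- move=> p /splitS[q [qF [c]]]; rewrite ad => ->.
  by exists (pihomog mdeg (d - a i) c); rewrite addrK; split=> //; apply: pihomogP.
by apply: (@is_qdim_homog _ _ (d - a i)).
Qed.

End HomogeneousSequence.

(** The recursion of [hdim_partial_idealS] only sees the degrees. *)
Lemma hdim_partial_ideal_degrees a f g i d : (i <= n)%N ->
    (forall j, f j \is (a j).-homog) -> (forall j, g j \is (a j).-homog) ->
    nonzerodivisors f -> nonzerodivisors g ->
  hdim (piece (partial_ideal f i) d) = hdim (piece (partial_ideal g i) d).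
Proof.
move=> + fa ga f_nzd g_nzd; elim: i d => [|i IHi] d lt_in.
  by apply: (@eq_hdim _ _ d) => [p []|p] //; split=> -[pd [c ->]]; split;
    rewrite ?big_pred0 ?dhomog0 //; exists (fun _ => 0); rewrite !big_pred0.
rewrite (hdim_partial_idealS fa (Ordinal lt_in) d f_nzd).
rewrite (hdim_partial_idealS ga (Ordinal lt_in) d g_nzd) /= (IHi d (ltnW lt_in)); congr (_ + _)%N.
case: ifP => // _; apply/eq_hilbertP; last exact: IHi (ltnW lt_in).
  exact/ideal_subspace/partial_ideal_ideal.
exact/ideal_subspace/partial_ideal_ideal.
Qed.

Lemma partial_ideal_pure a i p :
  partial_ideal (fun j => 'X_[pure a j]) i p <->
  monomial_span (fun m => exists2 j : 'I_n, (j < i)%N & (a j <= m j)%N) p.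
Proof.
split.
  apply: partial_ideal_sub => [|j ji].
    apply: monomial_span_ideal => u v [j ji jv]; exists j => //.
    by rewrite mnmDE (leq_trans jv) // leq_addl.
  by apply/monomial_spanX; exists j; rewrite // pureE eqxx.
apply: subspace_monomial_span => [|m [j ji]].
  exact/ideal_subspace/partial_ideal_ideal.
rewrite -pure_lepm => /submK <-; rewrite mpolyXD.
by case: (partial_ideal_ideal (fun j => 'X_[pure a j]) i) => _ _; apply;
  apply: partial_ideal_mem.
Qed.

Lemma partial_ideal_all_pure a p :
  partial_ideal (fun j => 'X_[pure a j]) n p <->
  monomial_span (fun m => pure_multiple a m) p.
Proof.
rewrite partial_ideal_pure; split=> pX m /pX => [[i _ im]|/existsP[i im]].
  by apply/existsP; exists i.
by exists i.
Qed.

(** Multiplying by a power of [x_i] does not change the exponents of the other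
    variables. *)
Lemma pure_nonzerodivisors a : nonzerodivisors (fun j => 'X_[pure a j]).
Proof.
move=> i g /partial_ideal_pure gS; apply/partial_ideal_pure => m mg.
have [|j ji jm] := gS (pure a i + m)%MM.
  by rewrite mcoeff_msupp mcoeffMX -mcoeff_msupp.
by exists j => //; move: jm; rewrite mnmDE pureE -val_eqE gtn_eqF.
Qed.

End RegularSequences.

(** * Ideals given degree by degree *)

Section Gluing.
Variables (k : fieldType) (n : nat).
Local Notation R := {mpoly k[n]}.
Implicit Types (p : R).

Lemma ideal_of_variables (J : R -> Prop) : subspace J ->
  (forall l p, J p -> J ('X_l * p)) -> is_ideal J.
Proof.
move=> JP JX; split=> [|p q|r p Jp]; [exact: JP.1|exact: subspaceD|].
rewrite [r]mpolyE mulr_suml; apply: subspace_sum => // m _.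
rewrite -scalerAl; apply: subspaceZ => //.
move: {2}(mdeg m) (erefl (mdeg m)) => d; elim: d m => [|d IHd] m md.
  by move/eqP: md; rewrite mdeg_eq0 => /eqP ->; rewrite mpolyX0 mul1r.
by have [l [u [-> ud]]] := mnm_pick md; rewrite mpolyXD -mulrA; apply/JX/IHd.
Qed.

Variable G : nat -> R -> Prop.
Hypothesis G_subspace : forall d, subspace (G d).
Hypothesis G_mul : forall l d p, p \is d.-homog -> G d p -> G d.+1 ('X_l * p).

Definition glue p := forall d, G d (pihomog mdeg d p).

Lemma glue_piece d p : piece glue d p <-> p \is d.-homog /\ G d p.
Proof.
split=> [] [pd pG]; split=> //; first by have := pG d; rewrite pihomog_dE.
move=> e; have [<-|ne] := eqVneq d e; first by rewrite pihomog_dE.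
by rewrite (pihomog_ne0 ne pd); apply: (G_subspace e).1.
Qed.

Lemma glue_homogeneous : homogeneous_ideal glue.
Proof.
have glueP : subspace glue.
  split=> [d|c p q pG qG d]; first by rewrite raddf0; apply: (G_subspace d).1.
  by rewrite linearP; apply: (G_subspace d).2.
split=> [|p d pG]; last first.
  by apply: (proj2 ((glue_piece d _).2 _)); split; rewrite ?pihomogP.
apply: ideal_of_variables => // l p pG [|d].
  by rewrite pihomog_mulX_lt ?mdeg1 //; apply: (G_subspace 0).1.
rewrite -add1n -(mdeg1 l) pihomog_mulX mdeg1 add1n; apply: G_mul => //.
exact: pihomogP.
Qed.

End Gluing.

(** * Truncating a lex plus powers ideal *)

Section Truncation.
Variables (n : nat) (a : 'I_n -> nat) (S : 'X_{1..n} -> Prop).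
Hypothesis S_lpp : lpp_monomials a S.
Variables (l0 : 'I_n) (u0 : 'X_{1..n}) (t : nat).
Let m0 := (U_(l0) + u0)%MM.
Hypotheses (u0_deg : mdeg u0 = t) (Su0 : S u0) (m0_box : ~~ pure_multiple a m0).

(** The monomials of the ideal [M] of the top comment. *)
Definition lex_truncation (m : 'X_{1..n}) : Prop :=
  if (mdeg m <= t)%N then (pure_multiple a m : Prop)
  else if mdeg m == t.+1 then pure_multiple a m \/ lex_lt m0 m else S m.

Let Sup := lpp_upclosed S_lpp.

Let m0_deg : mdeg m0 = t.+1.
Proof. by rewrite mdegD mdeg1 u0_deg. Qed.

Lemma lex_truncation_sub m : lex_truncation m -> S m.
Proof.
rewrite /lex_truncation; case: ifP => _; first exact: lpp_pure.
case: eqP => // md [/(lpp_pure S_lpp) //|lt_m].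
by apply: (lpp_lex S_lpp _ m0_box _ lt_m); [apply: Sup|rewrite md].
Qed.

Lemma lex_truncation_pure m : pure_multiple a m -> lex_truncation m.
Proof.
move=> am; rewrite /lex_truncation; case: ifP => // _; case: eqP => _.
  by left.
exact: lpp_pure S_lpp _ am.
Qed.

Lemma lex_truncation_lpp : lpp_monomials a lex_truncation.
Proof.
split=> [u v Tv|m|i c /lex_truncation_sub|m m' Tm mbox m'm lt_mm'].
- have [av|av] := boolP (pure_multiple a v).
    exact/lex_truncation_pure/pure_multiple_upclosed.
  have [->|u0n] := eqVneq u 0%MM; first by rewrite add0m.
  have Sv := lex_truncation_sub Tv; move: Tv; rewrite /lex_truncation mdegD.
  have du : (0 < mdeg u)%N by rewrite lt0n mdeg_eq0.
  have [vt|tv] := leqP (mdeg v) t; first by rewrite (negPf av).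
  move=> _; have lt_uv : (t.+1 < mdeg u + mdeg v)%N by rewrite -add1n leq_add.
  by rewrite leqNgt (ltn_trans _ lt_uv) //= gtn_eqF //; apply: Sup.
- exact: lex_truncation_pure.
- exact: lpp_pure_min.
have Sm := lex_truncation_sub Tm; move: Tm; rewrite /lex_truncation m'm (negPf mbox).
case: ifP => // _; case: eqP => [md [//|lt_m]|_ _].
  right; apply/lex_ltP; first by rewrite m'm md.
  apply: (@lt_trans _ _ m); apply/lex_ltP => //; by rewrite md.
exact: (lpp_lex S_lpp Sm).
Qed.

(** A monomial [m] lexicographically smaller than [u0] has, by
    [lex_lt_multiple], a multiple by a variable that is not larger than [m0] and
    not a multiple of a power, hence lies outside of the truncation. *)
Lemma lex_truncation_colon m : mdeg m = t ->
  (forall l, lex_truncation (U_(l) + m)) -> S m /\ m <> u0.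
Proof.
move=> mt Tm.
have u0_box : ~~ pure_multiple a u0.
  by apply: contra m0_box => /pure_multiple_upclosed; apply.
have lex_irr u : ~ lex_lt u u by case=> i [_]; rewrite ltnn.
have TmE l : ~~ pure_multiple a (U_(l) + m)%MM -> lex_lt m0 (U_(l) + m).
  move=> lm; have := Tm l; rewrite /lex_truncation mdegD mdeg1 mt ltnn eqxx.
  by case=> // /(negP lm).
have [am|mbox] := boolP (pure_multiple a m).
  by split=> [|mu]; [apply: lpp_pure S_lpp _ am|rewrite mu (negPf u0_box) in am].
have m_neq : m <> u0.
  by move=> mu; have := TmE l0; rewrite mu => /(_ m0_box)/lex_irr.
split=> //; have mu : mdeg m = mdeg u0 by rewrite mt.
case: (ltgtP m u0) => [/(lex_ltP mu) lt_m|/(lex_ltP (esym mu)) lt_u|//].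
  have [j [jbox [jE|lt_j]]] := lex_lt_multiple mu lt_m mbox m0_box.
    by have := TmE j jbox; rewrite jE => /lex_irr.
  have := TmE j jbox; move: lt_j.
  have jm : mdeg (U_(j) + m)%MM = mdeg m0 by rewrite mdegD mdeg1 mt m0_deg.
  by move=> /(lex_ltP jm) /lt_trans lt_j /(lex_ltP (esym jm)) /lt_j; rewrite ltxx.
exact: (lpp_lex S_lpp Su0).
Qed.

End Truncation.

(** * Comparison of generators *)

Section Comparison.
Variables (k : fieldType) (n : nat).
Local Notation R := {mpoly k[n]}.
Implicit Types (I J L : R -> Prop) (p q : R) (a : 'I_n -> nat) (t : nat).

Lemma hdim_betti1 I t : homogeneous_ideal I ->
  hdim (piece I t.+1) = (hdim (linear_multiples I t) + betti I 1 t.+1)%N.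
Proof.
move=> I_hom; have [II _] := I_hom; have IP := ideal_subspace II.
have LP := linear_multiples_subspace t IP.
rewrite (@hdim_add _ _ t.+1 _ (linear_multiples I t)) //.
- by rewrite (is_qdim_qdim LP (betti1P t I_hom)).
- by move=> p [].
- by move=> p; apply: linear_multiples_piece.
Qed.

Lemma hdim_betti_top J t : (0 < n)%N -> is_ideal J ->
  hdim (piece (socle J) t) = (hdim (piece J t) + betti J n (t + n))%N.
Proof.
move=> n_gt0 JJ; have JP := piece_subspace t (ideal_subspace JJ).
rewrite (@hdim_add _ _ t _ (piece J t)) //; last 2 first.
- by move=> p [].
- by move=> p [pd Jp]; split=> // l; case: JJ => _ _; apply.
congr (_ + _)%N; apply: (is_qdim_qdim JP).
apply: (eq_is_qdim _ _ _ (betti_topP t n_gt0 JJ)) => //.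
  by move=> p [pd _]; split=> [|[]].
exact: socle_piece_subspace.
Qed.

(** The space [R_1 I_t + <h_i : a_i = t + 1>]; for [h] in [I] it contains the
    degree [t + 1] part of the ideal of [h]. *)
Definition with_generators I (h : 'I_n -> R) a t p :=
  exists (c : 'I_n -> k),
    linear_multiples I t (p - \sum_(i in [set i | a i == t.+1]) c i *: h i).

Section WithGenerators.
Variables (I : R -> Prop) (h : 'I_n -> R) (a : 'I_n -> nat) (t : nat).
Hypotheses (II : is_ideal I) (Ih : forall i, I (h i)).
Hypothesis h_homog : forall i, h i \is (a i).-homog.

Let LP := linear_multiples_subspace t (ideal_subspace II).

Lemma linear_multiples_with_generators p :
  linear_multiples I t p -> with_generators I h a t p.
Proof. by exists (fun _ => 0); rewrite big1 ?subr0 // => i _; rewrite scale0r. Qed.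

Lemma with_generators_mem i : a i = t.+1 -> with_generators I h a t (h i).
Proof.
move=> ai; exists (fun j => (j == i)%:R).
rewrite (bigD1 i) ?inE ?ai //= eqxx scale1r big1 ?addr0 ?subrr; first exact: LP.1.
by move=> j /andP[_ /negPf ->]; rewrite scale0r.
Qed.

Lemma with_generators_subspace : subspace (with_generators I h a t).
Proof.
split=> [|c p q [b pb] [d qd]].
  by apply: linear_multiples_with_generators; apply: LP.1.
exists (fun i => c * b i + d i); have := LP.2 c _ _ pb qd; congr linear_multiples.
rewrite scalerBr addrACA -opprD; congr (_ - _).
rewrite scaler_sumr -big_split; apply: eq_bigr => i _.
by rewrite scalerDl scalerA.
Qed.

Lemma with_generators_piece p : with_generators I h a t p -> piece I t.+1 p.
Proof.
have PP := piece_subspace t.+1 (ideal_subspace II).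
case=> c /(linear_multiples_piece II) pc.
rewrite -[p](subrK (\sum_(i in [set i | a i == t.+1]) c i *: h i)).
apply: (subspaceD PP) => //; apply: (subspace_sum PP) => i; rewrite inE => /eqP ai.
by apply: (subspaceZ PP); split; rewrite -?ai.
Qed.

(** In a combination of the [h i] of degree [t + 1], the coefficient of [h i] is
    a constant if [a i = t + 1], and otherwise lies in the ideal of the
    variables. *)
Lemma partial_ideal_with_generators p :
  piece (partial_ideal h n) t.+1 p -> with_generators I h a t p.
Proof.
have WP := with_generators_subspace.
case=> pd [c pE]; rewrite -(pihomog_dE pd) pE (pihomog_lincomb h_homog).
apply: (subspace_sum WP) => i _; case: leqP => ai; last first.
  by rewrite mul0r; apply: WP.1.
have [aE|ne] := eqVneq (a i) t.+1.
  rewrite aE subnn; set q := pihomog _ _ _.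
  have /dhomogP q0 : q \is 0.-homog := pihomogP _ _ _.
  have -> : q = (q@_0%MM)%:MP.
    apply/mpolyP => m; rewrite mcoeffC; have [->|m0] := eqVneq m 0%MM.
      by rewrite mulr1.
    by apply/eqP; rewrite mulr0 mcoeff_eq0; apply: contra m0 => /q0/eqP; rewrite mdeg_eq0.
  by rewrite mul_mpolyC; apply: (subspaceZ WP); apply: with_generators_mem.
have lt_a : (a i <= t)%N by rewrite -ltnS ltn_neqAle ne.
rewrite subSn //; have [u [ud ->]] := homog_split (pihomogP mdeg (t - a i).+1 (c i)).
apply: linear_multiples_with_generators; exists (fun l => u l * h i); split.
  move=> l; split; first by rewrite -(subnK lt_a); apply: dhomogM => //; case: (ud l).
  by case: II => _ _; apply.
by rewrite mulr_suml; apply: eq_bigr => l _; rewrite mulrA.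
Qed.

Let gensE (c : 'I_n -> k) :
  \sum_(i in [set i | a i == t.+1]) c i *: h i =
  \sum_(j < #|[set i | a i == t.+1]|) c (enum_val j) *: h (enum_val j).
Proof. by rewrite big_enum_val. Qed.

Let hdimE : hdim (with_generators I h a t) =
  (hdim (linear_multiples I t) + qdim (with_generators I h a t) (linear_multiples I t))%N.
Proof.
apply: (@hdim_add _ _ t.+1) => // p; first by case/with_generators_piece.
exact: linear_multiples_with_generators.
Qed.

Lemma hdim_with_generators_le :
  (hdim (with_generators I h a t) <=
   hdim (linear_multiples I t) + #|[set i | a i == t.+1]|)%N.
Proof.
rewrite hdimE leq_add2l.
have [v [vW v_indep _]] : is_qdim (with_generators I h a t) (linear_multiples I t)
    (qdim (with_generators I h a t) (linear_multiples I t)).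
  by apply: (@is_qdim_homog _ _ t.+1) => // p /with_generators_piece[].
apply: (independent_le_spanning LP v_indep (w := fun j => h (enum_val j))) => i.
by have [c] := vW i; rewrite gensE => vc; exists (fun j => c (enum_val j)).
Qed.

Lemma hdim_with_generators :
    independent (linear_multiples I t)
      (fun j : 'I_#|[set i | a i == t.+1]| => h (enum_val j)) ->
  hdim (with_generators I h a t) =
  (hdim (linear_multiples I t) + #|[set i | a i == t.+1]|)%N.
Proof.
move=> h_indep; rewrite hdimE; congr (_ + _)%N; apply: is_qdim_qdim => //.
exists (fun j => h (enum_val j)); split=> // [j|p [c]].
  by apply: with_generators_mem; have := enum_valP j; rewrite inE => /eqP.
by rewrite gensE => pc; exists (fun j => c (enum_val j)).
Qed.

End WithGenerators.

Lemma monomial_ideal_homogeneous S L : upclosed S ->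
  (forall p, L p <-> monomial_span S p) -> homogeneous_ideal L.
Proof.
move=> Sup LS; have [[S0 SD SM] S_hom] := @monomial_span_homogeneous k n S Sup.
split; last by move=> p d /LS Sp; apply/LS/S_hom.
split=> [|p q /LS Sp /LS Sq|r p /LS Sp]; apply/LS => //; [exact: SD|exact: SM].
Qed.

(** A power [x_i^a_i] occurring in a product of a variable with an element of
    [L] would give [x_i^(a_i - 1)] in [L], against its minimality. *)
Lemma hdim_with_pure_powers a S L t :
    (forall i, 0 < a i)%N -> lpp_monomials a S ->
    (forall p, L p <-> monomial_span S p) ->
  hdim (with_generators L (fun i => 'X_[pure a i]) a t) =
  (hdim (linear_multiples L t) + #|[set i | a i == t.+1]|)%N.
Proof.
move=> a_gt0 S_lpp LS; apply: hdim_with_generators.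
- by case: (monomial_ideal_homogeneous (lpp_upclosed S_lpp) LS).
- by move=> i; apply/LS/monomial_spanX/(lpp_pure S_lpp)/pure_multiple_pure.
- by move=> i; rewrite dhomogX; apply/eqP/mdeg_pure.
move=> c [u [uS uE]] j; apply/eqP; apply: contraT => cj.
pose i := enum_val j.
have : pure a i \in msupp (\sum_l 'X_l * u l).
  rewrite -uE mcoeff_msupp raddf_sum (bigD1 j) //= mcoeffZ mcoeffX eqxx mulr1.
  rewrite big1 ?addr0 // => j' /negPf j'j; rewrite mcoeffZ mcoeffX.
  rewrite [_ == _](negPf _) ?mulr0 //; apply: contraFneq j'j => /mnmP/(_ i).
  rewrite !pureE eqxx; case: eqP => [/enum_val_inj -> //|_ ai].
  by have := a_gt0 i; rewrite -ai.
move/msupp_sum_le/flatten_mapP => -[l _ /msuppM_le/allpairsP[[x y] /= []]].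
rewrite msuppX inE => /eqP -> yu iE; have [_ /LS/(_ _ yu) Sy] := uS l.
have li : l = i.
  by move/mnmP/(_ l): iE; rewrite mnmU_eq pureE eq_sym; case: eqP.
have /lepm_mulmn[yE ya] : (y <= pure a i)%MM by rewrite iE lem_addl.
rewrite yE in Sy; have := lpp_pure_min S_lpp Sy.
by move/mnmP/(_ i): iE; rewrite pureE eqxx li mnmU_eq => ->; rewrite ltnn.
Qed.

End Comparison.

Lemma ex_minimal_monomial n (Q : 'X_{1..n} -> Prop) m : Q m ->
  exists2 m0, Q m0 & forall m', Q m' -> (m0 <= m')%O.
Proof.
move: m; apply: ltmwf => m IHm Qm.
have [m_min|] := classic (forall m', Q m' -> (m <= m')%O); first by exists m.
case/not_all_ex_not => m' nm'; have [Qm' /negP] := imply_to_and _ _ nm'.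
by rewrite -ltNge => /IHm; apply.
Qed.

Section TwoIdeals.
Variables (k : fieldType) (n : nat) (a : 'I_n -> nat) (t : nat).
Local Notation R := {mpoly k[n]}.
Local Notation x := (fun i => 'X_[pure a i] : R).
Implicit Types (p : R) (m : 'X_{1..n}).

(** The monomial [x_l u] is the lexicographically last one outside of the pure
    powers in the span on which the hypothesis bears, so subtracting its multiple
    leaves only pure multiples and larger monomials. *)
Lemma ex_last_nonpure_multiple (L : R -> Prop) S : lpp_monomials a S ->
    (forall p, L p <-> monomial_span S p) ->
    ~ (forall p, with_generators L x a t p -> piece (partial_ideal x n) t.+1 p) ->
  exists l u, [/\ mdeg u = t, S u, ~~ pure_multiple a (U_(l) + u)%MM &
    forall p, with_generators L x a t p ->
      exists c, piece (monomial_span (lex_truncation a S l u t)) t.+1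
                  (p - c *: 'X_[U_(l) + u])].
Proof.
move=> S_lpp LS not_pure; pose PL := with_generators L x a t.
have [LL _] := monomial_ideal_homogeneous (lpp_upclosed S_lpp) LS.
have PL_homog p : PL p -> p \is t.+1.-homog.
  case/(@with_generators_piece _ _ _ x a t LL) => // i.
    exact/LS/monomial_spanX/(lpp_pure S_lpp)/pure_multiple_pure.
  by rewrite dhomogX; apply/eqP/mdeg_pure.
pose Q m := [/\ mdeg m = t.+1, ~~ pure_multiple a m &
  exists (l : 'I_n) u, m = (U_(l) + u)%MM /\ S u].
have PL_Q p m : PL p -> m \in msupp p -> ~~ pure_multiple a m -> Q m.
  move=> PLp mp mbox; split=> //; first exact: dhomog_mf (PL_homog p PLp) _ mp.
  case: PLp => c [u [uL uE]].
  have : m \in msupp (\sum_l 'X_l * u l).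
    rewrite -uE mcoeff_msupp mcoeffB raddf_sum /= big1 ?subr0 -?mcoeff_msupp // => i _.
    rewrite mcoeffZ mcoeffX; case: eqP => [mE|_]; last by rewrite mulr0.
    by rewrite -mE pure_multiple_pure in mbox.
  move/msupp_sum_le/flatten_mapP => -[l _ /msuppM_le/allpairsP[[v w] /= []]].
  rewrite msuppX inE => /eqP -> wu ->; exists l, w; split=> //.
  by have [_ /LS] := uL l; apply.
have [m1 Qm1] : exists m, Q m.
  apply: NNPP => no_Q; apply: not_pure => p PLp; split; first exact: PL_homog.
  apply/partial_ideal_all_pure => m mp; apply: contraT => mbox; case: no_Q; exists m.
  exact: PL_Q mp mbox.
have [m0 [m0_deg m0_box [l [u [m0E Su]]]] m0_min] := ex_minimal_monomial Qm1.
rewrite m0E in m0_deg m0_box m0_min.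
exists l, u; split=> //; first by apply: succn_inj; rewrite -m0_deg mdegD mdeg1.
move=> p PLp; have pd := PL_homog p PLp; exists p@_(U_(l) + u); split.
  by apply: (subspaceB (subspace_homog k n _)) => //; apply: dhomogZ; rewrite dhomogX; apply/eqP.
move=> m; rewrite mcoeff_msupp mcoeffB mcoeffZ mcoeffX.
have [<-|ne] := eqVneq (U_(l) + u)%MM m; first by rewrite mulr1 subrr eqxx.
rewrite mulr0 subr0 -mcoeff_msupp => mp.
have md := dhomog_mf pd mp; rewrite /lex_truncation md ltnn eqxx.
have [am|mbox] := boolP (pure_multiple a m); [by left|right].
apply/lex_ltP; first by rewrite md.
by rewrite lt_neqAle ne; apply/m0_min/(PL_Q p).
Qed.

(** The ideal is glued from the ideal of [f], a space of dimension [w] and [I]. The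
    lower bound on [w] leaves room for the multiples of [I_t], so that [I_t]
    becomes part of the socle. *)
Lemma ex_ideal_prescribed_dim (I : R -> Prop) f w : homogeneous_ideal I ->
    (forall i, I (f i)) -> (forall i, f i \is (a i).-homog) ->
    (hdim (with_generators I f a t) <= w <= hdim (piece I t.+1))%N ->
  exists J, [/\ homogeneous_ideal J, forall i, J (f i),
    forall p, piece I t p -> socle J p &
    forall d, hdim (piece J d) =
      if (d <= t)%N then hdim (piece (partial_ideal f n) d)
      else if d == t.+1 then w else hdim (piece I d)].
Proof.
move=> [II I_hom] If f_homog w_bounds; have IP := ideal_subspace II.
pose F := partial_ideal f n; pose PI := with_generators I f a t.
have PIP : subspace PI := with_generators_subspace f a t II.
have PI_I p : PI p -> piece I t.+1 p := @with_generators_piece _ _ _ _ _ _ II If f_homog p.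
have [W [WP PI_W W_I W_dim]] : exists W, [/\ subspace W, forall p, PI p -> W p,
    forall p, W p -> piece I t.+1 p & is_qdim W (@zerospace k R) w].
  apply: (ex_subspace_between PIP (piece_subspace t.+1 IP) PI_I _ _ w_bounds).
  - by apply: (@hdimP _ _ t.+1) => p /PI_I[].
  - by apply: (@hdimP _ _ t.+1) => p [].
pose G d : R -> Prop := if (d <= t)%N then F else if d == t.+1 then W else I.
have FF := partial_ideal_ideal f n; have FP := ideal_subspace FF.
have G_subspace d : subspace (G d) by rewrite /G; case: ifP => // _; case: ifP.
have F_W p : piece F t.+1 p -> W p.
  by move/(partial_ideal_with_generators II If f_homog)/PI_W.
have G_mul l d p : p \is d.-homog -> G d p -> G d.+1 ('X_l * p).
  move=> pd; rewrite /G eqSS; case: (ltngtP d t) => [_|dt|dE] Gp.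
  - by case: FF => _ _; apply.
  - case: II => _ _; apply.
    by move: Gp; case: ifP => // _ /W_I[].
  - by apply: F_W; split; [rewrite -dE; apply: homog_mulX|case: FF => _ _; apply].
exists (glue G); split; first exact: glue_homogeneous.
- move=> i d; have [<-|ne] := eqVneq (a i) d; last first.
    by rewrite (pihomog_ne0 ne (f_homog i)); apply: (G_subspace d).1.
  have Ff : F (f i) by apply: partial_ideal_mem.
  rewrite pihomog_dE // /G; case: ifP => // _; case: eqP => // ai.
  by apply: F_W; split; rewrite -?ai.
- move=> p [pd Ip] l; apply: (proj2 ((glue_piece G_subspace t.+1 _).2 _)).
  split; first exact: homog_mulX.
  rewrite /G ltnn eqxx; apply/PI_W/linear_multiples_with_generators.
  exact: linear_multiples_mulX.
move=> d; rewrite (@eq_hdim _ _ d _ (fun p => p \is d.-homog /\ G d p)); last 2 first.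
- by move=> p [].
- by move=> p; apply: glue_piece.
rewrite /G; case: ifP => // _; case: eqP => // ->.
rewrite -(is_qdim_qdim (zerospaceP _) W_dim).
by apply: (@eq_hdim _ _ t.+1) => [p [] //|p]; split=> [[]//|Wp]; split=> //; case: (W_I p Wp).
Qed.

End TwoIdeals.

Theorem theorem10 (k : fieldType) (n : nat)
    (lpp_socles : lpp_socle_conjecture k n)
    (a : 'I_n -> nat) (L I : {mpoly k[n]} -> Prop)
    (a_degrees : degree_list a)
    (L_lpp : lex_plus_powers a L)
    (I_hom : homogeneous_ideal I)
    (I_reg : contains_regular_sequence a I)
    (eq_hilbert : forall d, hilbert L d = hilbert I d) :
  forall j, (betti I 1 j <= betti L 1 j)%N.
Proof.
have [a_gt0 _] := a_degrees; have [f [f_homog f_reg If]] := I_reg.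
have [II _] := I_hom; have IP := ideal_subspace II.
have [S S_lpp LS] := lex_plus_powers_monomials L_lpp.
have L_hom := monomial_ideal_homogeneous (lpp_upclosed S_lpp) LS.
have [LL _] := L_hom; have LP := ideal_subspace LL.
have hdim_LI d : hdim (piece L d) = hdim (piece I d) by apply/eq_hilbertP.
case=> [|t]; first by rewrite !betti10.
rewrite leqNgt; apply/negP => lt_betti.
pose x i : {mpoly k[n]} := 'X_[pure a i].
have x_homog i : x i \is (a i).-homog by rewrite dhomogX; apply/eqP/mdeg_pure.
have Lx i : L (x i).
  exact/LS/monomial_spanX/(lpp_pure S_lpp)/pure_multiple_pure.
pose F := partial_ideal f n; pose X := partial_ideal x n.
have hdim_FX d : hdim (piece F d) = hdim (piece X d).
  apply: hdim_partial_ideal_degrees => //; first exact: regular_nonzerodivisors.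
  exact: pure_nonzerodivisors.
pose PI := with_generators I f a t; pose PL := with_generators L x a t.
have PI_I p : PI p -> piece I t.+1 p := @with_generators_piece _ _ _ _ _ _ II If f_homog p.
have PL_L p : PL p -> piece L t.+1 p := @with_generators_piece _ _ _ _ _ _ LL Lx x_homog p.
(* Here both generator counts enter: the dimensions in degree [t + 1] agree, so
   the excess of generators of [I] is a deficit of its linear multiples. *)
have lt_PI_PL : (hdim PI < hdim PL)%N.
  rewrite /PL (hdim_with_pure_powers _ a_gt0 S_lpp LS).
  apply: leq_ltn_trans (hdim_with_generators_le t II If f_homog) _.
  rewrite ltn_add2r -(ltn_add2r (betti L 1 t.+1)) -hdim_betti1 // hdim_LI hdim_betti1 //.
  by rewrite ltn_add2l.
have [l0 [u0 [u0_deg Su0 m0_box PL_M]]] : exists l u, [/\ mdeg u = t, S u,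
    ~~ pure_multiple a (U_(l) + u)%MM & forall p, PL p -> exists c,
      piece (monomial_span (lex_truncation a S l u t)) t.+1 (p - c *: 'X_[U_(l) + u])].
  apply: (ex_last_nonpure_multiple S_lpp LS) => PL_X.
  have : (hdim PL <= hdim PI)%N; last by rewrite leqNgt lt_PI_PL.
  apply: (@leq_trans (hdim (piece F t.+1))).
    by rewrite hdim_FX; apply: (@hdim_le _ _ t.+1) => // p [].
  apply: (@hdim_le _ _ t.+1) => [p /PI_I[] //|p].
  exact: partial_ideal_with_generators.
have n_gt0 : (0 < n)%N := leq_ltn_trans (leq0n _) (ltn_ord l0).
pose T := lex_truncation a S l0 u0 t; pose M := @monomial_span k n T.
have T_lpp : lpp_monomials a T := lex_truncation_lpp S_lpp u0_deg Su0 m0_box.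
have MM : is_ideal M := monomial_span_ideal k (lpp_upclosed T_lpp).
have M_L p : M p -> L p.
  by move=> pM; apply/LS => m /pM; apply: lex_truncation_sub.
have le_PL_M : (hdim PL <= (hdim (piece M t.+1)).+1)%N.
  apply: (is_qdim_leS (zerospaceP _) PL_M).
  - by apply: (@hdimP _ _ t.+1) => p /PL_L[].
  - by apply: (@hdimP _ _ t.+1) => p [].
have [|J [J_hom Jf J_socle J_dim]] :=
    @ex_ideal_prescribed_dim _ _ a t I f (hdim (piece M t.+1)) I_hom If f_homog.
  rewrite -ltnS (leq_trans lt_PI_PL le_PL_M) -hdim_LI.
  by apply: (@hdim_le _ _ t.+1) => p [] // pd /M_L.
have [JJ _] := J_hom.
have hdim_J d : hdim (piece J d) = hdim (piece M d).
  rewrite J_dim; case: ifP => [dt|].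
    rewrite -/F hdim_FX; apply: (@eq_hdim _ _ d) => [p [] //|p].
    split=> -[pd pM]; split=> //; last first.
      apply/partial_ideal_all_pure => m mp; have := pM m mp.
      by rewrite /T /lex_truncation (dhomog_mf pd mp) dt.
    move=> m mp; move/partial_ideal_all_pure: pM => /(_ m mp).
    exact: lex_truncation_pure.
  case: eqP => [-> //|/eqP dt1 dt]; rewrite -hdim_LI.
  apply: (@eq_hdim _ _ d) => [p [] //|p]; split=> -[pd pM]; split=> //; last exact: M_L.
  move=> m mp; rewrite /T /lex_truncation (dhomog_mf pd mp) dt (negPf dt1).
  by move/LS: pM; apply.
have J_reg : contains_regular_sequence a J by exists f.
have eq_hilb d : hilbert M d = hilbert J d.
  by apply/eq_hilbertP; rewrite ?hdim_J //; apply: ideal_subspace.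
have le_socle := lpp_socles a M J a_degrees
  (lpp_monomials_lex_plus_powers k a_gt0 T_lpp) J_hom J_reg eq_hilb (t + n)%N.
have: (hdim (piece I t) < hdim (piece L t))%N; last by rewrite hdim_LI ltnn.
apply: (@leq_ltn_trans (hdim (piece (socle J) t))).
  by apply: (@hdim_le _ _ t) => [p [] //|p Ip]; split; [case: Ip|apply: J_socle].
(* The socle of [M] in degree [t] stays strictly below [L], as it misses [u0]. *)
have colon p m : piece (socle M) t p -> m \in msupp p -> S m /\ m <> u0.
  move=> [pd pM] mp; apply: (lex_truncation_colon S_lpp u0_deg Su0 m0_box).
    exact: dhomog_mf mp.
  by move=> l; apply: (pM l); rewrite mcoeff_msupp mcoeff_mulX_add -mcoeff_msupp.
apply: (@leq_ltn_trans (hdim (piece (socle M) t))).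
  by rewrite !hdim_betti_top // hdim_J leq_add2l.
apply: (@hdim_lt _ _ t _ _ 'X_[u0]) => [p [] //||p pM||/colon].
- exact: socle_piece_subspace.
- split; first by case: pM.
  by apply/LS => m /(colon p m pM)[].
- by split; [rewrite dhomogX; apply/eqP|apply/LS/monomial_spanX].
by case/(_ u0); rewrite ?msuppX ?mem_head.
Qed.
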